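(* Let $d\ge5$. For each $\varepsilon\in(0,1)$ there is a constant (even integer) $K=K(\varepsilon)\in\mathbb{N}$ such that $$\liminf_{n\to\infty}\mathbb{P}_v\big(v\in\Lambda_K(G_n^d)\big)\ge 1-\varepsilon.$$
   Context: $(X_n)_{n\ge0}$ is the simple random walk on the nearest-neighbour lattice $\mathbb{Z}^d$; $\mathbb{P}_v$ is its law when started at the source $X_0=v\in\mathbb{Z}^d$. $G_n^d$ is the $n$-step trace: the subgraph of $\mathbb{Z}^d$ consisting of the vertices $X_0,\dots,X_n$ and the edges $\{X_i,X_{i+1}\}$, $0\le i<n$. For an even integer $k\ge2$ and a finite connected graph $G$, $\Lambda_k(G)$ is the random set of vertices obtained as follows: select a uniformly random pair $(u,v)$ of diametric vertices of $G$ (vertices at graph distance $\mathrm{diam}(G)$), and output the $k/2$ vertices of $G$ closest to $u$ and the $k/2$ vertices of $G$ closest to $v$, in the graph distance of $G$ (a vertex counts as closest to itself; ties are broken by an arbitrary fixed rule; if $G$ has fewer than $k/2$ vertices, all of them are output). *)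

(* Defs.v *)
From HB Require Import structures.
From mathcomp Require Import all_boot all_order all_algebra.
From mathcomp Require Import finmap.
From mathcomp Require Import boolp reals ereal sequences.

Set Implicit Arguments.
Unset Strict Implicit.
Unset Printing Implicit Defensive.

Import Order.TTheory GRing.Theory Num.Theory.

Local Open Scope fset_scope.
Local Open Scope ring_scope.

Section FiniteGraphs.
Variable T : choiceType.

(* Finite simple graphs with vertices in T; an edge is a two-element subset of
   the vertex set.  The well-formedness condition is boolean, so two graphs with
   the same vertices and edges are equal. *)
Record finite_graph := FiniteGraph {
  vertices : {fset T};
  edges : {fset {fset T}};
  edges_wf :
    all (fun e : {fset T} => (e `<=` vertices) && (#|` e| == 2%N)) edges
}.

Definition adj (G : finite_graph) : rel T := fun x y => [fset x; y] \in edges G.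

Definition joined_by (G : finite_graph) (x y : T) (n : nat) : Prop :=
  exists p : seq T, [/\ path (adj G) x p, last x p = y & size p = n].

Definition connected_graph (G : finite_graph) : Prop :=
  vertices G != fset0 /\
  {in vertices G &, forall x y, exists n, joined_by G x y n}.

(* The value 0 for vertices that are not joined is a dummy: distances are used
   in connected graphs only. *)
Definition gdist (G : finite_graph) (x y : T) : nat :=
  match pselect (exists n, `[< joined_by G x y n >]) with
  | left joined => ex_minn joined
  | right _ => 0%N
  end.

Definition diam (G : finite_graph) : nat :=
  \max_(x <- vertices G) \max_(y <- vertices G) gdist G x y.

(* Pairs are ordered.  Since Lambda_of below is symmetric in the two vertices,
   drawing an unordered pair uniformly would give the same random set. *)
Definition diametric_pairs (G : finite_graph) : {fset T * T} :=
  [fset p in vertices G `*` vertices G | gdist G p.1 p.2 == diam G].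

(* An arbitrary way of breaking ties, as a selection function: [closest G u m]
   consists of m vertices of G closest to u in the distance of G (u being at
   distance 0), or of all the vertices of G if there are fewer than m. *)
Definition closest_rule (closest : finite_graph -> T -> nat -> {fset T}) :
    Prop :=
  forall (G : finite_graph) (u : T) (m : nat),
    connected_graph G -> u \in vertices G ->
    [/\ closest G u m `<=` vertices G,
        #|` closest G u m| = minn m #|` vertices G| &
        forall x y, x \in closest G u m ->
          y \in vertices G `\` closest G u m ->
          (gdist G u x <= gdist G u y)%N].

Variable closest : finite_graph -> T -> nat -> {fset T}.

Definition Lambda_of (k : nat) (G : finite_graph) (p : T * T) : {fset T} :=
  closest G p.1 k./2 `|` closest G p.2 k./2.

(* Probability that the random set Lambda_k(G) has the property A, for a fixed
   graph G: the pair of diametric vertices is uniform. *)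
Definition Lambda_prob (R : realType) (k : nat) (G : finite_graph)
    (A : pred {fset T}) : R :=
  #|` [fset p in diametric_pairs G | A (Lambda_of k G p)]|%:R
    / #|` diametric_pairs G|%:R.

End FiniteGraphs.

Section SimpleRandomWalk.
Variable d : nat.

(* The 2d steps of the walk: a coordinate direction and a sign. *)
Definition step : finType := ('I_d * bool)%type.

Definition step_vec (s : step) : 'rV[int]_d := (-1) ^+ s.2 *: delta_mx 0 s.1.

Definition walk (v : 'rV[int]_d) (w : seq step) (i : nat) : 'rV[int]_d :=
  v + \sum_(s <- take i w) step_vec s.

Definition trace_vertices (v : 'rV[int]_d) (w : seq step) : {fset 'rV[int]_d} :=
  [fset walk v w (val i) | i : 'I_(size w).+1].

Definition trace_edges (v : 'rV[int]_d) (w : seq step) :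
    {fset {fset 'rV[int]_d}} :=
  [fset [fset walk v w (val i); walk v w (val i).+1] | i : 'I_(size w)].

Lemma step_vec_neq0 (s : step) : step_vec s != 0.
Proof.
apply/eqP => /matrixP/(_ 0 s.1)/eqP.
by rewrite !mxE !eqxx mulr1 signr_eq0.
Qed.

Lemma walkS (v : 'rV[int]_d) (w : seq step) (i : nat) : (i < size w)%N ->
  exists s : step, walk v w i.+1 = walk v w i + step_vec s.
Proof.
move=> iw; have s0 : step by case: w iw => // s.
exists (nth s0 w i).
by rewrite /walk (take_nth s0) // -cats1 big_cat big_seq1 addrA.
Qed.

Lemma trace_wf (v : 'rV[int]_d) (w : seq step) :
  all (fun e : {fset 'rV[int]_d} =>
    (e `<=` trace_vertices v w) && (#|` e| == 2%N)) (trace_edges v w).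
Proof.
apply/allP => e /imfsetP[i _ ->] /=; apply/andP; split.
  apply/fsubsetP => x /fset2P[] ->; apply/imfsetP.
    by exists (widen_ord (leqnSn _) i).
  by exists (lift ord0 i).
have [s ->] := walkS v (ltn_ord i).
rewrite cardfs2 [in X in _ != X]addrC -subr_eq0 opprD addrC subrK.
by rewrite oppr_eq0 step_vec_neq0.
Qed.

Definition trace (v : 'rV[int]_d) (w : seq step) : finite_graph 'rV[int]_d :=
  FiniteGraph (trace_wf v w).

(* Expectation of a function of the first n steps of the simple random walk:
   the steps are independent and uniform, so all step sequences of length n are
   equally likely. *)
Definition srw_mean (R : realType) (n : nat) (f : n.-tuple step -> R) : R :=
  (\sum_(w : n.-tuple step) f w) / ((2 * d) ^ n)%:R.

Definition source_in_Lambda_prob (R : realType)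
    (closest : finite_graph 'rV[int]_d -> 'rV[int]_d -> nat -> {fset 'rV[int]_d})
    (k : nat) (v : 'rV[int]_d) (n : nat) : R :=
  srw_mean (fun w : n.-tuple step =>
    Lambda_prob closest R k (trace v w) (fun L => v \in L)).

End SimpleRandomWalk.

(* Main.v *)
Require Import Defs.
From mathcomp Require Import all_boot all_order all_algebra.
From mathcomp Require Import finmap.
From mathcomp Require Import reals ereal sequences.
From mathcomp Require Import boolp filter normedtype.
From mathcomp Require Import ring lra zify.

Set Implicit Arguments.
Unset Strict Implicit.
Unset Printing Implicit Defensive.

Import Order.TTheory GRing.Theory Num.Theory.

(** Why the theorem holds.  Call [s] a cut time of the walk when the positions up
    to time [s] are disjoint from the later ones; the edge crossed at a cut time
    is then a bridge of the trace, which every path between past and future has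
    to use.  In dimension at least five cut times have positive density, and
    this pins down diametric pairs.

    Let [(X_i, X_j)] be diametric with [i <= j], and let [s < i] be a cut time.
    All paths from [X_0] to [X_j] pass through [X_s], and a path from [X_0] to
    [X_s] crosses one bridge for each cut time below [s], so
      dist(X_0, X_j) >= #cuts below s + dist(X_s, X_j),
      dist(X_i, X_j) <= (i - s) + dist(X_s, X_j).
    By maximality of dist(X_i, X_j) the number of cut times below [s] is at most
    [i - s].  Hence if every time [i >= M] has a cut time [s < i] with more than
    [i - s] cut times below it ([well_cut M]), one of the two diametric vertices
    was visited before time [M] ([diametric_early]), so it is at distance less
    than [M] from the source.  The number of vertices in a ball of radius [M] of the
    lattice has a bound that does not depend on the centre, and [K] is twice
    this bound: were the source missing from the [K/2] vertices closest to that
    diametric vertex, these and the source would all fit in the ball.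

    It remains to find [M] with [well_cut M] of probability at least [1 - eps],
    uniformly in the length of the walk ([prob_well_cut]).
    - Heat kernel.  The probability to be at a given point after [m] steps is
      O(m^(-5/2)) ([prob_pos_le]).  Given the directions of the steps, the
      coordinates are independent one-dimensional walks whose lengths are the
      letter counts of a uniform word; squaring (Jensen) reduces the bound to
      the mean of a product of inverse counts, which an exact size-biasing
      identity evaluates ([mean_size_bias]).
    - Since 5/2 > 2, the expected number of pairs [a <= s < b] with [X_a = X_b]
      and [b - a >= r] is O(r^(-1/2)) ([sum_decay_le]).
    - Positive density.  If the walk goes straight for a long while around time
      [r], meetings across [r] become unlikely, so the middle of a walk of
      length [2 r] is a cut time with probability bounded below
      ([prob_cut_mid]).
    - Concentration.  In a window of length [r^2], being a cut time for the
      [2 r] steps around is a property of finite range [r], to which Chebyshev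
      applies; it differs from being a cut time only by meetings at time
      distance at least [r], which Markov's inequality controls
      ([prob_few_cuts_le]).  With [r = 4^k] the failure probability is
      O(2^(-k)), and it is summed over the windows [[j 16^k, (j+1) 16^k)],
      [k >= k1], [j < 16 A].  When all of them have many cut times, a late time
      [i] has a cut time at distance O(i/A) below it while a constant multiple
      of [i] cut times lie lower still ([well_cut_of_dense]). *)

(** * Averages over words *)

Section Mean.
Local Open Scope ring_scope.
Variables (R : realFieldType) (A : finType).
Hypothesis A_gt0 : (0 < #|A|)%N.
Implicit Types (f g : seq A -> R) (n m : nat) (w u : seq A).

(** Averaging one letter at a time turns the independence of disjoint blocks of
    letters into an induction ([mean_cat], [mean_factor]); [mean_tupleE] is the
    link with the uniform average over words. *)
Fixpoint mean n f : R :=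
  if n is m.+1 then (\sum_a mean m (fun w => f (a :: w))) / #|A|%:R else f [::].

Lemma mean0 f : mean 0 f = f [::].
Proof. by []. Qed.

Lemma meanS n f :
  mean n.+1 f = (\sum_a mean n (fun w => f (a :: w))) / #|A|%:R.
Proof. by []. Qed.

Lemma eq_mean n f g :
  (forall w, size w = n -> f w = g w) -> mean n f = mean n g.
Proof.
elim: n f g => [|n IH] f g fg; first exact: fg.
rewrite !meanS; congr (_ / _); apply: eq_bigr => a _.
by apply: IH => w sw; apply: fg; rewrite /= sw.
Qed.

Lemma meanD n f g : mean n (fun w => f w + g w) = mean n f + mean n g.
Proof.
elim: n f g => [//|n IH] f g; rewrite !meanS -mulrDl -big_split /=.
by congr (_ / _); apply: eq_bigr => a _; rewrite IH.
Qed.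

Lemma meanZ n c f : mean n (fun w => c * f w) = c * mean n f.
Proof.
elim: n f => [//|n IH] f; rewrite !meanS mulrA mulr_sumr.
by congr (_ / _); apply: eq_bigr => a _; rewrite IH.
Qed.

Lemma mean_sum n (I : Type) (r : seq I) (P : pred I) (F : I -> seq A -> R) :
  mean n (fun w => \sum_(i <- r | P i) F i w) =
    \sum_(i <- r | P i) mean n (F i).
Proof.
elim: n F => [//|n IH] F; rewrite !meanS.
under eq_bigr do rewrite IH.
by rewrite exchange_big mulr_suml; apply: eq_bigr => i _.
Qed.

Lemma mean_cst n (c : R) : mean n (fun=> c) = c.
Proof.
elim: n => [//|n IH]; rewrite meanS; under eq_bigr do rewrite IH.
by rewrite sumr_const -[c *+ _]mulr_natr mulfK // pnatr_eq0 -lt0n.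
Qed.

Lemma ler_mean n f g :
  (forall w, size w = n -> f w <= g w) -> mean n f <= mean n g.
Proof.
elim: n f g => [|n IH] f g fg; first exact: fg.
rewrite !meanS ler_wpM2r ?invr_ge0 //; apply: ler_sum => a _.
by apply: IH => w sw; apply: fg; rewrite /= sw.
Qed.

Lemma mean_ge0 n f : (forall w, size w = n -> 0 <= f w) -> 0 <= mean n f.
Proof. by move=> f0; rewrite -(mean_cst n 0); apply: ler_mean. Qed.

Lemma mean_cat m n f :
  mean (m + n) f = mean m (fun u => mean n (fun w => f (u ++ w))).
Proof.
elim: m f => [//|m IH] f; rewrite addSn !meanS.
by congr (_ / _); apply: eq_bigr => a _; rewrite IH.
Qed.

Lemma mean_factor x m n f g : (x + m <= n)%N ->
  mean n (fun w => f (take x w) * g (take m (drop x w))) =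
    mean x f * mean m g.
Proof.
move=> le_n; rewrite -(subnKC le_n) -addnA mean_cat.
rewrite (eq_mean (g := fun u => mean m g * f u)); first by rewrite meanZ mulrC.
move=> u su.
rewrite (eq_mean (g := fun w => f u * g (take m w))); last first.
  by move=> w _; rewrite take_size_cat // drop_size_cat.
rewrite meanZ mulrC mean_cat; congr (_ * _).
apply: eq_mean => v sv.
by rewrite -[RHS](mean_cst (n - (x + m))); apply: eq_mean => w _;
  rewrite take_size_cat.
Qed.

Lemma mean_segment x m n g : (x + m <= n)%N ->
  mean n (fun w => g (take m (drop x w))) = mean m g.
Proof.
move=> le_n; rewrite -[RHS]mul1r -(mean_cst x 1) -(mean_factor _ _ le_n).
by apply: eq_mean => w _; rewrite mul1r.
Qed.

Lemma mean_segments_indep x m y p n f g : (x + m <= y)%N -> (y + p <= n)%N ->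
  mean n (fun w => f (take m (drop x w)) * g (take p (drop y w))) =
    mean m f * mean p g.
Proof.
move=> le_y le_n; rewrite -(mean_segment f le_y) -(mean_factor _ _ le_n).
apply: eq_mean => w _; congr (f _ * _).
by rewrite !take_drop take_takel // addnC.
Qed.

(** Jensen's inequality for the square: a variance is nonnegative. *)
Lemma mean_sqr_le n f : mean n f ^+ 2 <= mean n (fun w => f w ^+ 2).
Proof.
have : 0 <= mean n (fun w => (f w - mean n f) ^+ 2).
  by apply: mean_ge0 => w _; apply: sqr_ge0.
rewrite (eq_mean (g := fun w => f w ^+ 2 + ((- 2 * mean n f) * f w
  + mean n f ^+ 2))); last by move=> w _; ring.
rewrite meanD meanD meanZ mean_cst; set a := mean n f; set b := mean n _.
lra.
Qed.

(** Prescribing a stretch of letters costs no more than the probability of that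
    stretch. *)
Lemma mean_ge_point f w : (forall u, 0 <= f u) ->
  f w / #|A|%:R ^+ size w <= mean (size w) f.
Proof.
elim: w f => [|a w IH] f f0; first by rewrite expr0 divr1.
rewrite exprSr invfM mulrA [size _]/= meanS ler_wpM2r ?invr_ge0 //.
rewrite (bigD1 a) //= -[leLHS]addr0 lerD //.
  exact: (IH (fun w => f (a :: w))).
by apply: sumr_ge0 => b _; apply: mean_ge0.
Qed.

Lemma mean_tupleE n f :
  mean n f = (\sum_(w : n.-tuple A) f w) / (#|A| ^ n)%:R.
Proof.
elim: n f => [|n IH] f.
  rewrite (bigD1 [tuple]) //= big1 ?addr0 ?divr1 //.
  by move=> w; rewrite tuple0.
rewrite meanS expnSr natrM invfM mulrA; congr (_ / _).
under eq_bigr do rewrite IH; rewrite -mulr_suml; congr (_ / _).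
rewrite pair_big /= (reindex (fun p : A * n.-tuple A => [tuple of p.1 :: p.2])).
  by apply: eq_bigr.
exists (fun w : n.+1.-tuple A => (thead w, [tuple of behead w])) => w _ /=.
  by case: w => a w /=; congr pair; apply: val_inj.
by rewrite [w in RHS]tuple_eta.
Qed.

End Mean.

Arguments mean : simpl never.

(** * The one-dimensional walk and letter counts *)

(** At or above the middle, 'C(n, k) / 2^n is multiplied by
    (n + 1) / (2 (k + 1)) <= (n + 1) / (n + 2) when both arguments grow. *)
Lemma sqr_bin_step_up n k : (n.+2 <= 2 * k.+1)%N ->
  ('C(n, k) ^ 2 * n.+1 <= 4 ^ n -> 'C(n.+1, k.+1) ^ 2 * n.+2 <= 4 ^ n.+1)%N.
Proof.
move=> le_nk IH; have := mul_bin_diag n.+1 k; rewrite /= => binE.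
rewrite -(@leq_pmul2l (k.+1 ^ 2)) ?expn_gt0 // mulnA -expnMn -binE expnMn.
have -> : (n.+1 ^ 2 * 'C(n, k) ^ 2 * n.+2 =
    n.+1 * n.+2 * ('C(n, k) ^ 2 * n.+1))%N by ring.
apply: (leq_trans (leq_mul (leqnn _) IH)).
rewrite [X in (_ <= X)%N](_ : _ = (2 * k.+1) ^ 2 * 4 ^ n)%N; last first.
  by rewrite (expnS 4) expnMn mulnCA mulnA.
by rewrite leq_mul2r; apply/orP; right; nia.
Qed.

(** From one central coefficient to the next the factor of 'C(2 k, k) / 4^k is
    (2 k + 1) / (2 k + 2), and (2 k + 1) (2 k + 3) <= (2 k + 2)^2. *)
Lemma sqr_bin_step_mid k :
  ('C(k.*2, k) ^ 2 * k.*2.+1 <= 4 ^ k.*2 ->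
   'C(k.*2.+2, k.+1) ^ 2 * k.*2.+3 <= 4 ^ k.*2.+2)%N.
Proof.
move=> IH; have /= bin1 := mul_bin_diag k.*2.+2 k.
have /= bin2 := mul_bin_diag k.*2.+1 k.
have binS : 'C(k.*2.+1, k) = 'C(k.*2.+1, k.+1).
  rewrite -bin_sub; last by rewrite -addnn; lia.
  by congr ('C(_, _)); rewrite -addnn; lia.
have binE : (k.+1 * 'C(k.*2.+2, k.+1) = 2 * (k.*2.+1 * 'C(k.*2, k)))%N.
  by rewrite -bin1 bin2 binS -muln2; nia.
rewrite -(@leq_pmul2l (k.+1 ^ 2)) ?expn_gt0 // mulnA -expnMn binE !expnMn.
have -> : (2 ^ 2 * (k.*2.+1 ^ 2 * 'C(k.*2, k) ^ 2) * k.*2.+3 =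
   4 * k.*2.+1 * k.*2.+3 * ('C(k.*2, k) ^ 2 * k.*2.+1))%N by ring.
apply: (leq_trans (leq_mul (leqnn _) IH)).
rewrite !(expnS 4) !mulnA leq_mul2r; apply/orP; right.
rewrite -muln2; nia.
Qed.

(** The bound 'C(n, k) / 2^n <= (n + 1)^(-1/2), squared to stay in the integers.
    Off the middle the symmetry of the coefficients allows one to climb. *)
Lemma sqr_bin_le n k : ('C(n, k) ^ 2 * n.+1 <= 4 ^ n)%N.
Proof.
elim/ltn_ind: n k => -[|n] IH k; first by case: k.
have step j : (n.+2 <= 2 * j)%N -> ('C(n.+1, j) ^ 2 * n.+2 <= 4 ^ n.+1)%N.
  by case: j => [|j] // le_nj; apply: sqr_bin_step_up => //; apply: IH.
have [le_nk|lt_kn] := leqP n.+2 (2 * k); first exact: step.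
have [le_kn|] := leqP (2 * k) n.
  have le_k : (k <= n.+1)%N by lia.
  by rewrite -bin_sub //; apply: step; lia.
case: k lt_kn => [//|k] lt_kn lt_nk.
have -> : n = k.*2.+1 by rewrite -muln2; lia.
by apply: sqr_bin_step_mid; apply: IH; rewrite -muln2; lia.
Qed.

Section OneDimensionalWalk.
Local Open Scope ring_scope.
Variable R : realFieldType.

(** The law of the simple random walk on the integers after [n] steps. *)
Fixpoint srw1 n (y : int) : R :=
  if n is m.+1 then (srw1 m (y - 1) + srw1 m (y + 1)) / 2 else (y == 0)%:R.

(** Extended by zero to negative arguments, the coefficients satisfy Pascal's rule
    without boundary cases. *)
Definition binz n (z : int) : nat := if z is Posz k then 'C(n, k) else 0%N.

Lemma binzS n z : binz n.+1 z = (binz n z + binz n (z - 1))%N.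
Proof.
case: z => [[|k]|k]; last by rewrite /= add0n.
  by rewrite /= !bin0.
by have -> : Posz k.+1 - 1 = Posz k by lia.
Qed.

(** With [z] steps down among [n] the walk is at [n - 2 z]; the other points have
    the wrong parity. *)
Lemma srw1_binz n z :
  srw1 n (n%:Z - 2 * z) = (binz n z)%:R / 2 ^+ n /\ srw1 n (n%:Z - 2 * z - 1) = 0.
Proof.
elim: n z => [|n IH] z /=.
  split; last by rewrite (_ : _ == 0 = false) //; apply/eqP; lia.
  by rewrite expr0 divr1; congr (_%:R); case: z => [[|k]|k].
have [IHz IHz'] := IH z; have [IHw IHw'] := IH (z - 1).
split.
  rewrite (_ : n.+1%:Z - 2 * z - 1 = n%:Z - 2 * z); last by lia.
  rewrite (_ : n.+1%:Z - 2 * z + 1 = n%:Z - 2 * (z - 1)); last by lia.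
  by rewrite IHz IHw -mulrDl -natrD -binzS exprSr invfM mulrA.
rewrite (_ : n.+1%:Z - 2 * z - 1 - 1 = n%:Z - 2 * z - 1); last by lia.
rewrite (_ : n.+1%:Z - 2 * z - 1 + 1 = n%:Z - 2 * (z - 1) - 1); last by lia.
by rewrite IHz' IHw' addr0 mul0r.
Qed.

Lemma sqr_srw1_le n y : srw1 n y ^+ 2 <= n.+1%:R^-1.
Proof.
have [z [->|->]] : exists z, y = n%:Z - 2 * z \/ y = n%:Z - 2 * z - 1 
    by exists ((n%:Z - y) %/ 2)%Z; lia.
  rewrite (srw1_binz n z).1 expr_div_n.
  rewrite ler_pdivrMr ?exprn_gt0 // ler_pdivlMl ?ltr0n // -exprM mulnC exprM.
  rewrite -!natrX -natrM ler_nat mulnC; case: z => [k|k] //=.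
  exact: sqr_bin_le.
by rewrite (srw1_binz n z).2 expr0n invr_ge0.
Qed.

End OneDimensionalWalk.

Section LetterCounts.
Local Open Scope ring_scope.
Variables (R : realFieldType) (A : finType).
Implicit Types (h : seq A -> R) (psi : nat -> R).

(** Size biasing.  A word of length [m + 1] with a marked occurrence of [j] is a
    word of length [m] with one of [m + 1] places to insert [j]; the weight [h]
    is blind to the letter [j], so it is not changed by the insertion. *)
Lemma mean_size_bias m j h psi :
  (forall u w, h (u ++ j :: w) = h (u ++ w)) ->
  mean m.+1 (fun w => h w * (count_mem j w)%:R * psi (count_mem j w)) =
    m.+1%:R / #|A|%:R * mean m (fun w => h w * psi (count_mem j w).+1).
Proof.
elim: m h psi => [|m IH] h psi hj; rewrite meanS.
  rewrite (bigD1 j) //= big1 ?eqxx ?addr0.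
    by rewrite !mean0 (hj [::] [::]) /= addn0 mulr1 mul1r mulrC.
  by move=> i /negPf neq_ij; rewrite mean0 /= neq_ij addn0 mulr0 mul0r.
have step i : mean m.+1 (fun w => h (i :: w) * (count_mem j (i :: w))%:R *
      psi (count_mem j (i :: w))) =
    m.+1%:R / #|A|%:R *
      mean m (fun w => h (i :: w) * psi ((i == j) + count_mem j w).+1) +
    (i == j)%:R * mean m.+1 (fun w => h w * psi (count_mem j w).+1).
  have hi u w : h (i :: (u ++ j :: w)) = h (i :: (u ++ w)) by exact: (hj (i :: u)).
  have IHi := IH (fun w => h (i :: w)) (fun c => psi ((i == j) + c)%N) hi.
  have [ij|neq_ij] := eqVneq i j; rewrite ?(negPf neq_ij) ?ij ?eqxx /= in hi IHi *.
    rewrite mul1r -[X in X + _]IHi -meanD; apply: eq_mean => w _ /=.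
    by rewrite (hj [::] w) natrD eqxx /= add1n; ring.
  rewrite mul0r addr0 -[RHS]IHi.
  by apply: eq_mean => w _; rewrite (negPf neq_ij).
under eq_bigr do rewrite step.
have sum_delta c : \sum_i (i == j)%:R * c = c :> R.
  rewrite (bigD1 j) //= eqxx mul1r big1 ?addr0 // => i /negPf ->.
  by rewrite mul0r.
rewrite big_split /= sum_delta -mulr_sumr mulrDl -mulrA.
rewrite -(meanS m (fun w => h w * psi (count_mem j w).+1)).
by rewrite [m.+2%:R]mulrSr; ring.
Qed.

(** Size biasing with [psi c = 1 / c]: the inverse count is traded for a factor
    #|A| / (m + 1) and one more letter. *)
Lemma mean_inv_count m j h : (forall w, 0 <= h w) ->
  (forall u w, h (u ++ j :: w) = h (u ++ w)) ->
  mean m (fun w => h w / (count_mem j w).+1%:R) <=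
    #|A|%:R / m.+1%:R * mean m.+1 h.
Proof.
move=> h_ge0 hj; have A_gt0 : (0 < #|A|)%N by apply/card_gt0P; exists j.
rewrite -ler_pdivrMl ?divr_gt0 ?ltr0n // invf_div.
rewrite -(mean_size_bias _ (fun c => c%:R^-1) hj); apply: ler_mean => w _.
case: (count_mem j w) => [|c]; first by rewrite mulr0 mul0r.
by rewrite mulfK // pnatr_eq0.
Qed.

(** Inverse counts are of order #|A| / m on average, also jointly: this takes the
    place of large deviation estimates for multinomial counts. *)
Lemma mean_prod_inv_count_le m (J : seq A) : uniq J ->
  mean m (fun w => \prod_(i <- J) (count_mem i w).+1%:R^-1 : R) <=
    (#|A|%:R / m.+1%:R) ^+ size J.
Proof.
case: (posnP #|A|) => [A0|A_gt0].
  case: J => [|i J]; last by have := fintype0 i A0.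
  move=> _; case: m => [|m]; first by rewrite mean0 big_nil expr0.
  by rewrite meanS A0 invr0 mulr0 expr0.
elim: J m => [|i J IH] m /= => [_|/andP[iJ uJ]].
  by rewrite (eq_mean (g := fun=> 1)) ?mean_cst // => w _; rewrite big_nil.
rewrite (eq_mean (g := fun w =>
  (\prod_(i <- J) (count_mem i w).+1%:R^-1) / (count_mem i w).+1%:R)); last first.
  by move=> w _; rewrite big_cons mulrC.
apply: le_trans (mean_inv_count _ _ _) _ => [w|u w|].
- by rewrite prodr_ge0 // => k _; rewrite invr_ge0.
- rewrite big_seq [RHS]big_seq; apply: eq_bigr => k kJ.
  rewrite !count_cat /= [i == k](_ : _ = false) //.
  by apply/eqP => ik; rewrite ik kJ in iJ.
rewrite exprS ler_wpM2l ?divr_ge0 //; apply: (le_trans (IH _ uJ)).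
rewrite lerXn2r ?nnegrE ?divr_ge0 // ler_wpM2l //.
by rewrite lef_pV2 ?posrE ?ltr0n // ler_nat.
Qed.

End LetterCounts.

(** * The heat-kernel bound *)

Section HeatKernel.
Local Open Scope ring_scope.
Variables (R : rcfType) (d : nat).
Implicit Types (w : seq (step d)) (x : 'rV[int]_d).

Definition pos w : 'rV[int]_d := \sum_(s <- w) step_vec s.

Lemma pos_nil : pos [::] = 0.
Proof. exact: big_nil. Qed.

Lemma pos_cons s w : pos (s :: w) = step_vec s + pos w.
Proof. exact: big_cons. Qed.

Lemma pos_cat u w : pos (u ++ w) = pos u + pos w.
Proof. exact: big_cat. Qed.

Lemma card_step : #|step d| = (2 * d)%N.
Proof. by rewrite card_prod card_ord card_bool mulnC. Qed.

Lemma step_vecE (s : step d) j :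
  step_vec s 0 j = if j == s.1 then (-1) ^+ s.2 else 0.
Proof. by rewrite !mxE eqxx /=; case: eqP => _; rewrite ?mulr1 ?mulr0. Qed.

(** Given the directions, the signs make the coordinates independent walks on the
    integers, the [j]-th one with as many steps as the direction [j] occurs. *)
Lemma prob_pos m x :
  mean m (fun w => (pos w == x)%:R : R) =
    mean m (fun dirs : seq 'I_d => \prod_j srw1 R (count_mem j dirs) (x 0 j)).
Proof.
elim: m x => [|m IH] x.
  rewrite !mean0 pos_nil /=; have [<-|/eqP x0] := eqVneq 0 x.
    by rewrite big1 // => j _; rewrite mxE eqxx.
  have [j xj|x_eq0] := pickP (fun j => x 0 j != 0).
    by rewrite (bigD1 j) //= (negPf xj) mul0r.
  case: x0; apply/rowP => j; rewrite mxE; apply/esym/eqP.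
  by have /negbFE := x_eq0 j.
rewrite !meanS card_step card_ord natrM invfM mulrA; congr (_ / _).
have sum_step (F : step d -> R) : \sum_s F s = \sum_i \sum_b F (i, b).
  by rewrite pair_bigA; apply: eq_bigr => -[].
rewrite mulr_suml sum_step.
apply: eq_bigr => i _; rewrite -mulr_suml mulrC big_bool /=.
have shift b : mean m (fun w => (pos ((i, b) :: w) == x)%:R) =
    mean m (fun dirs : seq 'I_d =>
      srw1 R (count_mem i dirs) (x 0 i - (-1) ^+ b) *
      \prod_(j | j != i) srw1 R (count_mem j dirs) (x 0 j)).
  transitivity (mean m (fun w => (pos w == x - step_vec (i, b))%:R : R)).
    apply: eq_mean => w _.
    by rewrite pos_cons [in RHS]eq_sym subr_eq [pos w + _]addrC eq_sym.
  rewrite IH; apply: eq_mean => dirs _; rewrite (bigD1 i) //=.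
  have coordB j : (x - step_vec (i, b)) 0 j = x 0 j - step_vec (i, b) 0 j.
    by rewrite mxE [X in _ + X]mxE.
  rewrite coordB step_vecE eqxx; congr (_ * _).
  apply: eq_bigr => j /negPf ji.
  by rewrite coordB step_vecE ji subr0.
rewrite !shift -meanD -meanZ; apply: eq_mean => dirs _.
rewrite [RHS](bigD1 i) //= eqxx add1n /= expr1 expr0 opprK -mulrDl mulrA.
congr (_ * _); first by rewrite mulrC addrC.
by apply: eq_bigr => j /negPf; rewrite eq_sym => ->.
Qed.

(** Five of the coordinates are used, each contributing a factor (d / m)^(1/2)
    before squaring; the other ones are bounded by 1. *)
Lemma sqr_prob_pos_le m x : (5 <= d)%N ->
  mean m (fun w => (pos w == x)%:R : R) ^+ 2 <= (d%:R / m.+1%:R) ^+ 5.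
Proof.
move=> d5; have d_gt0 : (0 < #|'I_d|)%N by rewrite card_ord (leq_trans _ d5).
rewrite prob_pos; apply: (le_trans (mean_sqr_le d_gt0 _ _)).
pose J := take 5 (enum 'I_d).
have sJ : size J = 5 by rewrite size_takel // size_enum_ord.
have uJ : uniq J by rewrite take_uniq ?enum_uniq.
rewrite -[X in _ ^+ X]sJ -[d in d%:R](card_ord d).
apply: le_trans (mean_prod_inv_count_le R m uJ); apply: ler_mean => dirs _.
rewrite -prodrXl (bigID (mem J)) /= -[leRHS]mulr1 big_uniq //=.
apply: ler_pM; rewrite ?prodr_ge0 //.
- by move=> j _; apply: sqr_ge0.
- by move=> j _; apply: sqr_ge0.
- by apply: ler_prod => j _; rewrite sqr_ge0 sqr_srw1_le.
apply: prodr_ile1 => j _; rewrite sqr_ge0 (le_trans (sqr_srw1_le _ _ _)) //.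
by rewrite invf_le1 ?ltr0n // ler1n.
Qed.

(** The profile C N^(-5/2). *)
Definition decay (C N : R) : R := C / (N ^+ 2 * Num.sqrt N).

Lemma decay_ge0 C N : 0 <= C -> 0 <= decay C N.
Proof.
by move=> C_ge0; rewrite divr_ge0 // mulr_ge0 ?sqr_ge0 ?sqrtr_ge0.
Qed.

Lemma prob_pos_le m x : (5 <= d)%N ->
  mean m (fun w => (pos w == x)%:R : R) <= decay (d%:R ^+ 3) m.+1%:R.
Proof.
move=> d5; rewrite -(@ler_pXn2r _ 2) ?nnegrE //; last 2 first.
- by apply: mean_ge0 => // ; rewrite card_step muln_gt0 (leq_trans _ d5).
- exact: decay_ge0.
apply: (le_trans (sqr_prob_pos_le m x d5)).
rewrite /decay !expr_div_n [(_ * Num.sqrt _) ^+ 2]exprMn.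
rewrite sqr_sqrtr // -!exprM -exprSr.
rewrite ler_wpM2r ?invr_ge0 //.
 by apply: ler_weXn2l; rewrite // ler1n (leq_trans _ d5).
Qed.

End HeatKernel.

(** * Sums over pairs of times across a cut *)

Section CollisionSums.
Local Open Scope ring_scope.
Variable R : rcfType.

(** The series of N^(-3/2) is dominated by a telescoping one. *)
Lemma inv_sqrt_step N : (0 < N)%N ->
  (N%:R * Num.sqrt N%:R)^-1 <=
    4 * ((Num.sqrt N%:R)^-1 - (Num.sqrt N.+1%:R)^-1) :> R.
Proof.
move=> N_gt0; set x := Num.sqrt N%:R; set y := Num.sqrt N.+1%:R.
have x_gt0 : 0 < x :> R by rewrite sqrtr_gt0 ltr0n.
have y_gt0 : 0 < y :> R by rewrite sqrtr_gt0 ltr0n.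
have xx : x ^+ 2 = N%:R by rewrite sqr_sqrtr.
have yy : y ^+ 2 = x ^+ 2 + 1 by rewrite xx sqr_sqrtr // -natr1.
have x_ge1 : 1 <= x ^+ 2 by rewrite xx ler1n.
have le_xy : x <= y 
  by rewrite -(@ler_pXn2r _ 2) ?nnegrE ?(ltW x_gt0) ?(ltW y_gt0) // yy lerDl.
have -> : x^-1 - y^-1 = (x * y * (x + y))^-1.
  have xy0 : x + y != 0 by rewrite gt_eqF // addr_gt0.
  have <- : (y - x) / (x * y) = x^-1 - y^-1 by field; rewrite !gt_eqF.
  have -> : y - x = (x + y)^-1.
    by apply: (mulIf xy0); rewrite mulVf //; ring: yy.
  by rewrite [RHS]invfM mulrC.
rewrite -xx -[leLHS]mul1r ler_pdivlMr ?mulr_gt0 ?addr_gt0 //.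
rewrite mulrAC mul1r ler_pdivrMr ?mulr_gt0 ?exprn_gt0 //.
have : y * (x + y) <= 4 * x ^+ 2 by nra.
by move/(ler_wpM2l (ltW x_gt0)); lra.
Qed.

Lemma sum_inv_sqrt_le r m : (0 < r)%N ->
  \sum_(r <= N < r + m) (N%:R * Num.sqrt N%:R)^-1 <=
    4 / Num.sqrt r%:R - 4 / Num.sqrt (r + m)%:R :> R.
Proof.
move=> r_gt0; elim: m => [|m IH]; first by rewrite addn0 big_geq // subrr.
rewrite addnS big_nat_recr ?leq_addr //=.
have := inv_sqrt_step (ltn_addr m r_gt0); move: IH.
set a := bigop.body _ _ _; lra.
Qed.

(** Among the pairs [a <= s < b] at most [N] have [b - a = N]. *)
Lemma count_straddling s N :
  (\sum_(0 <= a < s.+1 | s.+1 - a <= N) 1 = minn N s.+1)%N.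
Proof.
elim: s => [|s IH]; first by rewrite big_mkcond big_nat1; case: N => [|[]].
rewrite big_mkcond big_nat_recl //= -big_mkcond /= subn0.
under eq_bigl do rewrite subSS.
by rewrite IH; case: leqP; lia.
Qed.

(** Grouping the pairs by [N = b - a] costs a factor [N], which leaves the tail of
    the series of N^(-3/2). *)
Lemma sum_decay_le C r s n : 0 <= C -> (0 < r)%N ->
  \sum_(0 <= a < s.+1) \sum_(s.+1 <= b < n.+1)
     (r <= b - a)%:R * decay C (b - a)%:R <= 4 * C / Num.sqrt r%:R :> R.
Proof.
move=> C_ge0 r_gt0; pose F N : R := (r <= N)%:R * decay C N%:R.
have F_ge0 N : 0 <= F N by rewrite mulr_ge0 // decay_ge0.
have inner a : (a <= s)%N ->
    \sum_(s.+1 <= b < n.+1) F (b - a)%N <=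
    \sum_(0 <= N < n.+1 | (s.+1 - a <= N)%N) F N.
  move=> le_as; rewrite -{1}(subnK (leqW le_as)) big_addn.
  under eq_bigr do rewrite addnK.
  rewrite (big_nat_widen _ _ n.+1) ?leq_subr // (big_nat_widenl _ 0) //=.
  rewrite [leRHS]big_mkcond [leLHS]big_mkcond; apply: ler_sum => N _.
  by case: (_ <= N)%N; case: (_ < _)%N => //=.
have : \sum_(0 <= a < s.+1) \sum_(s.+1 <= b < n.+1) F (b - a)%N <=
    \sum_(0 <= N < n.+1) F N * N%:R.
  apply: (@le_trans _ _ (\sum_(0 <= a < s.+1)
     \sum_(0 <= N < n.+1 | (s.+1 - a <= N)%N) F N)).
    by apply: ler_sum_nat => a /andP[_ le_as]; apply: inner.
  rewrite (exchange_big_dep predT) //=; apply: ler_sum => N _.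
  rewrite (eq_bigr (fun=> F N * 1%:R)) => [|a _]; last by rewrite mulr1.
  by rewrite -mulr_sumr ler_wpM2l // -natr_sum count_straddling ler_nat geq_minl.
move/le_trans; apply.
apply: (@le_trans _ _ (C * \sum_(r <= N < r + n.+1) (N%:R * Num.sqrt N%:R)^-1)).
  rewrite (big_nat_widen 0 _ (r + n.+1)) ?leq_addl // mulr_sumr.
  rewrite (big_nat_widenl r 0) // [leLHS]big_mkcond [leRHS]big_mkcond /=.
  apply: ler_sum => N _; rewrite /F.
  have [le_rN|lt_Nr] := leqP r N; last by rewrite !mul0r if_same.
  have N_gt0 : 0 < N%:R :> R by rewrite ltr0n (leq_trans r_gt0).
  have sN_gt0 : 0 < Num.sqrt N%:R :> R by rewrite sqrtr_gt0.
  have -> : true%:R * decay C N%:R * N%:R = C * (N%:R * Num.sqrt N%:R)^-1.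
    by rewrite /decay /=; field; rewrite !gt_eqF.
  by case: ifP => // _; rewrite mulr_ge0 // invr_ge0 ltW // mulr_gt0.
rewrite [4 * C]mulrC -mulrA ler_wpM2l //.
apply: (le_trans (sum_inv_sqrt_le _ r_gt0)).
by rewrite gerBl divr_ge0 // sqrtr_ge0.
Qed.

End CollisionSums.

(** * Cut times and meetings *)

Section Cuts.
Local Open Scope ring_scope.
Variables (R : rcfType) (d : nat).
Implicit Types (w u v : seq (step d)).

(** Meetings across time [s] between times at least [r] apart: [r = 0] gives all
    the obstructions to a cut at [s], a large [r] the non-local ones. *)
Definition meets r w s :=
  has (fun a => has (fun b =>
      (r <= b - a)%N && (pos (take a w) == pos (take b w)))
    (index_iota s.+1 (size w).+1)) (index_iota 0 s.+1).

Definition cut w s := ~~ meets 0 w s.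

Lemma meetsP r w s :
  reflect (exists a b, [/\ (a <= s)%N, (s < b <= size w)%N, (r <= b - a)%N &
    pos (take a w) = pos (take b w)]) (meets r w s).
Proof.
apply: (iffP hasP) => [[a a_s /hasP[b b_s /andP[le_r /eqP ab]]]|].
  by exists a, b; move: a_s b_s; rewrite !mem_index_iota !ltnS.
move=> [a [b [le_as b_s le_r ab]]]; exists a; first by rewrite mem_index_iota.
apply/hasP; exists b; first by rewrite mem_index_iota ltnS.
by rewrite le_r; apply/eqP.
Qed.

Lemma cutP w s :
  reflect (forall a b, (a <= s)%N -> (s < b <= size w)%N ->
    pos (take a w) <> pos (take b w)) (cut w s).
Proof.
apply: (iffP idP) => [/meetsP no_meet a b le_as b_s ab|no_meet].
  by apply: no_meet; exists a, b.
by apply/meetsP => -[a [b [le_as b_s _]]]; apply: no_meet.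
Qed.

Lemma has_le_sum (I : Type) (P : pred I) (r : seq I) (F : I -> R) :
  (forall i, (P i)%:R <= F i) -> (has P r)%:R <= \sum_(i <- r) F i.
Proof.
move=> leF; have F_ge0 i : 0 <= F i by rewrite (le_trans _ (leF i)).
elim: r => [|i r IH]; first by rewrite big_nil.
rewrite big_cons /=; apply: le_trans (lerD (leF i) IH).
by case: (P i); case: (has P r); rewrite /= ?addr0 ?add0r // lerDl.
Qed.

Lemma meets_le_sum r w s :
  (meets r w s)%:R <= \sum_(0 <= a < s.+1) \sum_(s.+1 <= b < (size w).+1)
    (r <= b - a)%:R * (pos (take a w) == pos (take b w))%:R :> R.
Proof.
apply: has_le_sum => a; apply: has_le_sum => b.
by case: (r <= b - a)%N; rewrite /= ?mul1r ?mul0r.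
Qed.

Lemma pos_take_eq w a b : (a <= b)%N ->
  (pos (take a w) == pos (take b w)) = (pos (take (b - a) (drop a w)) == 0).
Proof.
move=> le_ab; rewrite -{1}(subnKC le_ab) takeD pos_cat eq_sym.
by rewrite -subr_eq0 addrC addKr.
Qed.

Lemma decay_le C M N : 0 <= C -> 0 < M -> M <= N -> decay C N <= decay C M :> R.
Proof.
move=> C_ge0 M_gt0 le_MN; have N_gt0 := lt_le_trans M_gt0 le_MN.
have MsM_gt0 : 0 < M ^+ 2 * Num.sqrt M.
  by rewrite mulr_gt0 ?exprn_gt0 ?sqrtr_gt0.
rewrite ler_wpM2l // lef_pV2 ?posrE //; last first.
  by rewrite mulr_gt0 ?exprn_gt0 ?sqrtr_gt0.
apply: ler_pM; rewrite ?sqrtr_ge0 ?sqr_ge0 //.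
  by rewrite lerXn2r ?nnegrE ?(ltW M_gt0) ?(ltW N_gt0).
by rewrite ler_sqrt // ltW.
Qed.

(** Used to compare the number of free steps with a time difference at most twice
    as long. *)
Lemma decay4 C N : decay C (N / 4) = decay (32 * C) N :> R.
Proof.
rewrite /decay; have -> : Num.sqrt (N / 4) = Num.sqrt N / 2.
  have -> : N / 4 = N * (2 ^- 1) ^+ 2 by field.
  have [N_ge0|/ltW N_le0] := leP 0 N.
    by rewrite sqrtrM // sqrtr_sqr ger0_norm // invr_ge0 exprn_ge0.
  rewrite !ler0_sqrtr ?mul0r // mulr_le0_ge0 // exprn_ge0 //.
have [->|sN0] := eqVneq (Num.sqrt N) 0; first by rewrite !mul0r !mulr0 invr0 !mulr0.
have [->|N0] := eqVneq N 0; first by rewrite !mul0r expr0n /= !mul0r invr0 !mulr0.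
by field; rewrite N0 sN0.
Qed.

Hypothesis d5 : (5 <= d)%N.

Lemma step_gt0 : (0 < #|step d|)%N.
Proof. by rewrite card_step muln_gt0 (leq_trans _ d5). Qed.

Lemma prob_meet_le n a b : (a < b)%N -> (b <= n)%N ->
  mean n (fun w => (pos (take a w) == pos (take b w))%:R : R) <=
    decay (d%:R ^+ 3) (b - a)%:R.
Proof.
move=> lt_ab le_bn; under eq_mean do rewrite pos_take_eq ?(ltnW lt_ab) //.
rewrite (mean_segment step_gt0 (fun u => (pos u == 0)%:R)); last by lia.
apply: (le_trans (prob_pos_le R (b - a) 0 d5)).
by apply: decay_le; rewrite ?exprn_ge0 ?ltr0n ?ler_nat // subn_gt0.
Qed.

Lemma prob_meets_le n r s : (0 < r)%N ->
  mean n (fun w => (meets r w s)%:R : R) <= 4 * d%:R ^+ 3 / Num.sqrt r%:R.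
Proof.
move=> r_gt0.
apply: le_trans (sum_decay_le s n (exprn_ge0 3 (ler0n R d)) r_gt0).
apply: (@le_trans _ _ (mean n (fun w => \sum_(0 <= a < s.+1)
    \sum_(s.+1 <= b < n.+1)
      (r <= b - a)%:R * (pos (take a w) == pos (take b w))%:R : R))).
  by apply: ler_mean => w <-; apply: meets_le_sum.
rewrite mean_sum; apply: ler_sum_nat => a /andP[_ le_as].
rewrite mean_sum; apply: ler_sum_nat => b /andP[lt_sb le_bn].
rewrite meanZ ler_wpM2l // prob_meet_le //.
exact: leq_ltn_trans lt_sb.
Qed.

End Cuts.

(** * The middle of a walk is a cut time with positive probability *)

Lemma take_cat_full (T : Type) b (s1 s2 : seq T) :
  take b (s1 ++ s2) = take b s1 ++ take (b - size s1) s2.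
Proof.
rewrite take_cat; case: ltnP => [lt_b|le_b]; last by rewrite (take_oversize le_b).
rewrite (_ : b - size s1 = 0)%N ?take0 ?cats0 //; lia.
Qed.

Section MidpointCut.
Local Open Scope ring_scope.
Variables (R : rcfType) (d : nat).
Implicit Types (w u v : seq (step d)).

Lemma coord_pos_le w i : `|pos w 0 i| <= (size w)%:Z.
Proof.
elim: w => [|s w IH]; first by rewrite pos_nil mxE normr0.
rewrite pos_cons mxE /= intS.
apply: (le_trans (ler_normD _ _)); rewrite lerD //.
by rewrite step_vecE; case: eqP => _; rewrite ?normr0 // normrX normrN1 expr1n.
Qed.

Hypothesis d5 : (5 <= d)%N.

Let east : step d := (Ordinal (leq_trans (isT : 0 < 5)%N d5), false).

Lemma pos_nseq k : pos (nseq k east) = step_vec east *+ k.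
Proof.
elim: k => [|k IH]; first by rewrite pos_nil mulr0n.
by rewrite /= pos_cons IH mulrS.
Qed.

(** Going straight for [2 r0] steps around the middle keeps the two halves of the
    walk apart where they are most likely to meet. *)
Definition force l r0 v := take l v ++ (nseq r0.*2 east ++ drop l v).

Lemma size_force l r0 v : size v = l.*2 -> size (force l r0 v) = (l + r0).*2.
Proof.
move=> sv; rewrite !size_cat size_nseq size_drop size_takel sv -!addnn ?leq_addr //.
by rewrite addnK; ring.
Qed.

Lemma pos_take_force l r0 v b : size v = l.*2 ->
  pos (take b (force l r0 v)) =
    pos (take (minn b l) v) + step_vec east *+ minn (b - l) r0.*2 +
      pos (take (b - l - r0.*2) (drop l v)).
Proof.
move=> sv; have sl : size (take l v) = l by rewrite size_takel // sv -addnn leq_addr.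
rewrite /force take_cat_full sl take_cat_full size_nseq !pos_cat addrA.
congr (pos _ + _ + _); first by rewrite take_min.
rewrite -pos_nseq; have [le_b|/ltnW le_b] := leqP (b - l) r0.*2.
  by rewrite take_nseq.
by rewrite take_oversize // size_nseq.
Qed.

(** Between [a] and [b] there are [m] free steps, which are consecutive in [v];
    the other steps are inserted ones, which the free ones have to undo. *)
Lemma meet_force l r0 v a b : size v = l.*2 ->
  (a <= l + r0 < b)%N -> (b <= (l + r0).*2)%N ->
  let m := (l - a + (b - l - r0.*2))%N in
  pos (take a (force l r0 v)) = pos (take b (force l r0 v)) ->
  pos (take m (drop (minn a l) v)) = - (step_vec east *+ (b - a - m)).
Proof.
move=> sv /andP[le_a lt_b] le_b m; rewrite !pos_take_force //.
rewrite (_ : a - l - r0.*2 = 0)%N; last by lia.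
rewrite take0 pos_nil addr0 (_ : minn b l = minn a l + (l - a))%N; last by lia.
rewrite {1}/m !takeD !pos_cat drop_drop.
rewrite (_ : l - a + minn a l = l)%N; last by lia.
rewrite (_ : minn (b - l) r0.*2 = minn (a - l) r0.*2 + (b - a - m))%N; last first.
  by rewrite /m; lia.
rewrite mulrnDr; set p0 := pos (take (minn a l) v); set p1 := pos _.
set p2 := pos _; set x : 'rV[int]_d := step_vec east *+ _.
set y : 'rV[int]_d := step_vec east *+ _.
move=> /rowP eq_pos; apply/rowP => i; move: (eq_pos i).
have cancel (q0 q1 q2 z t : int) :
    q0 + z = q0 + q1 + (z + t) + q2 -> q1 + q2 = - t by lia.
by clearbody p0 p1 p2 x y; rewrite !mxE; apply: cancel.
Qed.

(** Undoing [sigma] equal steps takes [m >= sigma] free ones.  As [a] and [b] lie on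
    both sides of the middle, this forces [sigma >= r0], so that
    [b - a = m + sigma] is at least [2 r0] and at most [2 m]: short meetings are
    excluded, and long ones are, up to a constant, as rare as without insertion. *)
Lemma prob_meet_force l r0 a b : (a <= l + r0 < b)%N -> (b <= (l + r0).*2)%N ->
  mean l.*2 (fun v => (pos (take a (force l r0 v)) ==
                       pos (take b (force l r0 v)))%:R : R) <=
    (r0.*2 <= b - a)%:R * decay (32 * d%:R ^+ 3) (b - a)%:R.
Proof.
move=> /andP[le_a lt_b] le_b; set m := (l - a + (b - l - r0.*2))%N.
pose sigma := (b - a - m)%N; pose x : 'rV[int]_d := - (step_vec east *+ sigma).
have le_m : (minn a l + m <= l.*2)%N by rewrite /m; lia.
apply: (@le_trans _ _ (mean m (fun u => (pos u == x)%:R : R))).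
  rewrite -(mean_segment (step_gt0 d5) (fun u => (pos u == x)%:R) le_m).
  apply: ler_mean => v sv.
  have [/(meet_force sv _ le_b) -> |_ //] := eqP; first by rewrite eqxx.
  by rewrite le_a lt_b.
have [lt_m|le_sigma] := ltnP m sigma.
  rewrite (eq_mean (g := fun=> 0)) => [|u su].
    by rewrite mean_cst ?(step_gt0 d5) // mulr_ge0 // decay_ge0 // mulr_ge0.
  case: eqP => // ux; have := coord_pos_le u east.1.
  rewrite ux mxE normrN mulmxnE step_vecE eqxx expr0 su natz ger0_norm //; lia.
have le_r0 : (r0.*2 <= b - a)%N by rewrite /sigma /m in le_sigma *; lia.
rewrite le_r0 mul1r; apply: (le_trans (prob_pos_le R m x d5)).
rewrite -decay4; apply: decay_le; rewrite ?exprn_ge0 //.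
  by rewrite divr_gt0 // ltr0n; lia.
rewrite ler_pdivrMr // -natrM ler_nat; rewrite /sigma in le_sigma; lia.
Qed.

(** With [2 r0] equal steps inserted, the expected number of meetings across the
    middle is at most 1/2, at the price of a factor independent of [r]. *)
Lemma prob_cut_mid :
  exists r0 : nat, exists2 p : R, 0 < p &
    forall r, (r0 <= r)%N -> p <= mean r.*2 (fun w => (cut w r)%:R).
Proof.
(* Chosen such that 4 * 32 d^3 / sqrt (2 r0) <= 1/2, see [sum_decay_le]. *)
pose r0 := ((256 * d ^ 3) ^ 2)%N.
have d_gt0 : (0 < d)%N by rewrite (leq_trans _ d5).
have r0_gt0 : (0 < r0)%N by rewrite expn_gt0 muln_gt0 expn_gt0 d_gt0.
pose q : R := #|step d|%:R ^+ r0.*2.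
have q_gt0 : 0 < q by rewrite exprn_gt0 // ltr0n step_gt0.
exists r0; exists (2^-1 / q); first by rewrite divr_gt0.
move=> r le_r; pose l := (r - r0)%N.
have rE : r = (l + r0)%N by rewrite /l; lia.
have -> : r.*2 = (l + (r0.*2 + l))%N by rewrite rE; lia.
rewrite mean_cat.
have half : 2^-1 <= mean l.*2 (fun v => (cut (force l r0 v) r)%:R : R).
  have meets_half : mean l.*2 (fun v => (meets 0 (force l r0 v) r)%:R : R) <= 2^-1.
    apply: (@le_trans _ _ (4 * (32 * d%:R ^+ 3) / Num.sqrt r0.*2%:R)).
      have C_ge0 : 0 <= 32 * d%:R ^+ 3 :> R by rewrite mulr_ge0.
      have r0x2_gt0 : (0 < r0.*2)%N by rewrite double_gt0.
      apply: le_trans (sum_decay_le r r.*2 C_ge0 r0x2_gt0).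
      apply: (@le_trans _ _ (mean l.*2 (fun v => \sum_(0 <= a < r.+1)
          \sum_(r.+1 <= b < r.*2.+1)
          (pos (take a (force l r0 v)) == pos (take b (force l r0 v)))%:R : R))).
        apply: ler_mean => v sv; apply: (le_trans (meets_le_sum _ _ _ _)).
        by rewrite size_force // -rE; apply: ler_sum => a _; apply: ler_sum => b _;
          rewrite mul1r.
      rewrite mean_sum; apply: ler_sum_nat => a /andP[_ le_ar].
      rewrite mean_sum; apply: ler_sum_nat => b /andP[lt_rb le_br].
      by apply: prob_meet_force; rewrite -rE // -ltnS le_ar.
    have sqrt_ge : 256 * d%:R ^+ 3 <= Num.sqrt r0.*2%:R :> R.
      apply: (@le_trans _ _ (Num.sqrt r0%:R)); last first.
        by rewrite ler_sqrt ?ler_nat -?addnn ?leq_addr ?ltr0n ?addn_gt0 ?r0_gt0.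
      by rewrite natrX sqrtr_sqr natrM natrX ger0_norm // mulr_ge0 ?exprn_ge0.
    rewrite ler_pdivrMr ?(lt_le_trans _ sqrt_ge) //; last first.
      by rewrite mulr_gt0 ?exprn_gt0 ?ltr0n.
    by move: sqrt_ge; lra.
  rewrite (eq_mean (g := fun v => 1 + -1 * (meets 0 (force l r0 v) r)%:R)).
    rewrite meanD meanZ mean_cst ?(step_gt0 d5) //.
    by move: meets_half; set z := mean _ _; lra.
  by move=> v _; rewrite /cut; case: meets; rewrite /=; ring.
apply: (@le_trans _ _ (mean l (fun u => q^-1 *
    mean l (fun w => (cut (u ++ nseq r0.*2 east ++ w) r)%:R)))).
  rewrite meanZ mulrC ler_wpM2l ?invr_ge0 ?(ltW q_gt0) //.
  apply: (le_trans half); rewrite -addnn mean_cat; apply: ler_mean => u su.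
  by apply: ler_mean => w _; rewrite /force take_size_cat // drop_size_cat.
apply: ler_mean => u _; rewrite mean_cat.
have := mean_ge_point (step_gt0 d5) (nseq r0.*2 east)
  (f := fun x => mean l (fun w => (cut (u ++ x ++ w) r)%:R : R)).
rewrite size_nseq mulrC; apply => x.
by apply: mean_ge0 => //; apply: step_gt0.
Qed.

End MidpointCut.

(** * Density of cut times *)

Section CutDensity.
Local Open Scope ring_scope.
Variables (R : rcfType) (d : nat).
Implicit Types (w u v : seq (step d)).

Definition ncuts w x y : nat := \sum_(x <= s < y) cut w s.

(** Only the [2 r] steps around [s] matter, so that these events are independent
    for times at distance at least [2 r]. *)
Definition local_cut r w s := cut (take r.*2 (drop (s - r) w)) r.

Lemma local_cut_meets r w s : (r <= s)%N -> (s + r <= size w)%N ->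
  local_cut r w s -> cut w s || meets r w s.
Proof.
move=> le_rs le_sr /cutP loc; have [//|/=] := boolP (cut w s).
rewrite /cut negbK => /meetsP[a [b [le_as /andP[lt_sb le_b] _ meet]]].
have [le_r|lt_r] := leqP r (b - a).
  by apply/meetsP; exists a, b; rewrite lt_sb.
have sz : size (take r.*2 (drop (s - r) w)) = r.*2.
  by rewrite size_takel // size_drop; lia.
have take_local i : (s - r <= i <= s + r)%N ->
    pos (take i w) = pos (take (s - r) w) +
      pos (take (i - (s - r)) (take r.*2 (drop (s - r) w))).
  move=> /andP[ge_i le_i]; rewrite take_takel; last by lia.
  by rewrite -pos_cat -takeD subnKC.
case: (loc (a - (s - r)) (b - (s - r)))%N; rewrite ?sz; [lia|lia|].
by apply: (addrI (pos (take (s - r) w))); rewrite -!take_local //; lia.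
Qed.

Lemma sum_nat_window_le x y lo hi :
  (\sum_(x <= i < y) (lo <= i < hi) <= hi - lo)%N.
Proof.
rewrite (eq_bigr (fun i => if (lo <= i < hi)%N then 1%N else 0%N)); last first.
  by move=> i _; case: (_ && _).
rewrite -big_mkcond sum1_count -size_filter -(size_iota lo (hi - lo)).
apply: uniq_leq_size; first exact/filter_uniq/iota_uniq.
by move=> i; rewrite mem_filter mem_iota; lia.
Qed.

Hypothesis d5 : (5 <= d)%N.

Definition mid_prob r : R := mean r.*2 (fun u : seq (step d) => (cut u r)%:R).

(** Covariances vanish except for the at most [4 r] times near a given one. *)
Lemma variance_local_cuts n r x y : (r <= x)%N -> (y + r <= n)%N ->
  mean n (fun w =>
    (\sum_(x <= s < y) ((local_cut r w s)%:R - mid_prob r)) ^+ 2) <=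
    (y - x)%:R * (4 * r)%:R.
Proof.
move=> le_rx le_yn; set p := mid_prob r; have st0 := step_gt0 d5.
pose f u : R := (cut u r)%:R - p.
have f_mean : mean r.*2 f = 0.
  by rewrite /f meanD mean_cst // subrr.
have /andP[p_ge0 p_le1] : 0 <= p <= 1.
  rewrite -(mean_cst st0 r.*2 (0 : R)) -(mean_cst st0 r.*2 (1 : R)).
  rewrite !ler_mean // => u _.
  by case: cut.
have f_le1 u : `|f u| <= 1 
  by rewrite ler_norml /f; case: cut => /=; apply/andP; split; lra.
have cov s t : (x <= s < y)%N -> (x <= t < y)%N ->
    mean n (fun w => ((local_cut r w s)%:R - p) * ((local_cut r w t)%:R - p))
      <= (s.+1 - r.*2 <= t < s + r.*2)%:R.
  move=> s_xy t_xy; case: (boolP (_ <= t < _)%N) => [_|].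
    rewrite -[leRHS](mean_cst st0 n); apply: ler_mean => w _.
    rewrite (le_trans (ler_norm _)) // normrM.
    by apply: mulr_ile1 => //; apply: f_le1.
  have indep s' t' : (x <= s')%N -> (t' < y)%N -> (s' + r.*2 <= t')%N ->
      mean n (fun w => f (take r.*2 (drop (s' - r) w)) *
                       f (take r.*2 (drop (t' - r) w))) = 0.
    by move=> ? ? ?; rewrite mean_segments_indep ?f_mean ?mul0r //; lia.
  rewrite negb_and -ltnNge -leqNgt => /orP[lt_ts|le_st];
    rewrite le_eqVlt; apply/orP; left; apply/eqP.
    by rewrite -[RHS](indep t s); [|lia..]; apply: eq_mean => w _; rewrite mulrC.
  by rewrite -[RHS](indep s t); [|lia..].
rewrite (eq_mean (g := fun w => \sum_(x <= s < y) \sum_(x <= t < y)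
   ((local_cut r w s)%:R - p) * ((local_cut r w t)%:R - p))); last first.
  by move=> w _; rewrite expr2 mulr_suml; apply: eq_bigr => s _;
    rewrite mulr_sumr.
rewrite mean_sum mulr_natl -sumr_const_nat; apply: ler_sum_nat => s s_xy.
rewrite mean_sum.
apply: (@le_trans _ _ (\sum_(x <= t < y) (s.+1 - r.*2 <= t < s + r.*2)%:R)).
  by apply: ler_sum_nat => t; apply: cov.
by rewrite -natr_sum ler_nat (leq_trans (sum_nat_window_le _ _ _ _)) //; lia.
Qed.

End CutDensity.

Section Windows.
Local Open Scope ring_scope.
Variables (R : rcfType) (d : nat).
Implicit Types (w u v : seq (step d)).

Lemma ncuts_cat w x y z : (x <= y)%N -> (y <= z)%N ->
  ncuts w x z = (ncuts w x y + ncuts w y z)%N.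
Proof. by move=> xy yz; rewrite /ncuts (big_cat_nat xy yz). Qed.

Lemma ncuts_sub w a x y b : (a <= x)%N -> (x <= y)%N -> (y <= b)%N ->
  (ncuts w x y <= ncuts w a b)%N.
Proof.
move=> ax xy yb; rewrite (ncuts_cat w ax (leq_trans xy yb)) (ncuts_cat w xy yb).
by lia.
Qed.

Hypothesis d5 : (5 <= d)%N.

(** If there are fewer than [c T] cut times, [T = r^2], either the number of local
    cuts is off its mean, at least [3 c T], by [c T] (Chebyshev), or at least
    [c T] local cuts are spoilt by a meeting of times [r] apart (Markov).  The
    local cuts are counted at distance [r] from the ends of the window, where
    their [2 r] steps are steps of the word. *)
Lemma prob_few_cuts_le r (c : R) a n :
  0 < c -> (4 <= r)%N -> 6 * c <= mid_prob R d r -> (a + r ^ 2 <= n)%N ->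
  mean n (fun w => ((ncuts w a (a + r ^ 2))%:R < c * (r ^ 2)%:R :> R)%:R : R) <=
    4 / (c ^+ 2 * r%:R) + 4 * d%:R ^+ 3 / (c * Num.sqrt r%:R).
Proof.
move=> c_gt0 r_ge4 le_p le_n; pose T : R := (r ^ 2)%:R.
have r_gt0 : 0 < r%:R :> R by rewrite ltr0n; lia.
have T_gt0 : 0 < T by rewrite ltr0n expn_gt0; apply/orP; left; lia.
have cT_gt0 : 0 < c * T by rewrite mulr_gt0.
pose x := (a + r)%N; pose y := (a + r ^ 2 - r)%N.
have rr : (4 * r <= r ^ 2)%N by rewrite -mulnn leq_mul2r r_ge4 orbT.
have le_xy : (x <= y)%N by rewrite /x /y; lia.
pose p := mid_prob R d r.
pose S w : R := \sum_(x <= s < y) ((local_cut r w s)%:R - p).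
pose B w : R := \sum_(x <= s < y) (meets r w s)%:R.
have le_Lp : 3 * (c * T) <= (y - x)%:R * p.
  have : T / 2 <= (y - x)%:R.
    by rewrite ler_pdivrMr // -natrM ler_nat /x /y; lia.
  by move=> le_L; apply: le_trans (ler_pM _ _ le_L le_p); rewrite ?mulr_ge0 //;
    lra.
have few w : size w = n ->
    ((ncuts w a (a + r ^ 2))%:R < c * T :> R)%:R <=
    (c * T) ^- 2 * S w ^+ 2 + (c * T)^-1 * B w.
  move=> sw; have B_ge0 : 0 <= B w by apply: sumr_ge0.
  have S_ge : S w + (y - x)%:R * p <= (ncuts w a (a + r ^ 2))%:R + B w.
    apply: (@le_trans _ _ ((ncuts w x y)%:R + B w)); last first.
      by rewrite lerD2r ler_nat ncuts_sub // /x /y; lia.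
    rewrite /S sumrB sumr_const_nat mulr_natl subrK.
    rewrite /ncuts natr_sum -big_split /=; apply: ler_sum_nat => s s_xy.
    have := local_cut_meets (r := r) (w := w) (s := s); rewrite sw.
    case: local_cut => [/(_ _ _ isT)|_]; last by rewrite addr_ge0.
    have -> : (r <= s)%N by move: s_xy; rewrite /x; lia.
    have -> : (s + r <= n)%N by move: s_xy; rewrite /y; lia.
    by move=> /(_ isT isT); case: cut; case: meets => //= _;
      rewrite ?addr0 ?lerDl ?add0r.
  have [lt_few|_] := ltP; last first.
    by rewrite addr_ge0 // mulr_ge0 ?sqr_ge0 ?invr_ge0 ?exprn_ge0 // ltW.
  have [le_B|lt_B] := leP (c * T) (B w).
    rewrite -[leLHS]add0r lerD //.
      by rewrite mulr_ge0 ?sqr_ge0 // invr_ge0 exprn_ge0 // ltW.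
    by rewrite ler_pdivlMl // mulr1.
  rewrite -[leLHS]addr0 lerD //; last by rewrite mulr_ge0 // invr_ge0 ltW.
  rewrite ler_pdivlMl ?exprn_gt0 // mulr1 -[S w ^+ 2]sqrrN.
  have le_S : c * T <= - S w.
    move: S_ge le_Lp lt_few lt_B; set L := (_ * p); set N := (ncuts _ _ _)%:R.
    set cT := (c * T); lra.
  have cT_ge0 := ltW cT_gt0.
  by apply: lerXn2r; rewrite ?nnegrE //; apply: le_trans le_S.
apply: (le_trans (ler_mean few)); rewrite meanD !meanZ lerD //.
  rewrite ler_pdivrMl ?exprn_gt0 //.
  apply: (le_trans (variance_local_cuts R d5 _ _)); [by rewrite leq_addl|..].
    by rewrite /y; lia.
  have -> : (c * T) ^+ 2 * (4 / (c ^+ 2 * r%:R)) = T * (4 * r)%:R.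
    rewrite natrM /T natrX; field.
    by rewrite !gt_eqF.
  by rewrite ler_wpM2r // ler_nat /x /y; lia.
rewrite ler_pdivrMl // mean_sum.
have -> : c * T * (4 * d%:R ^+ 3 / (c * Num.sqrt r%:R)) =
    T * (4 * d%:R ^+ 3 / Num.sqrt r%:R).
  by field; rewrite !gt_eqF // sqrtr_gt0.
apply: (@le_trans _ _ (\sum_(x <= s < y) 4 * d%:R ^+ 3 / Num.sqrt r%:R)).
  by apply: ler_sum => s _; apply: prob_meets_le => //; lia.
rewrite sumr_const_nat -[leLHS]mulr_natl ler_wpM2r //.
by rewrite ler_nat /x /y; lia.
Qed.

(** The scales [T = 16^k] and [r = 4^k] make the bound geometric in [k]. *)
Lemma prob_few_cuts_scale :
  exists k0 : nat, exists2 c : R, 0 < c & exists2 C : R, 0 <= C &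
  forall k a n, (k0 <= k)%N -> (a + 16 ^ k <= n)%N ->
    mean n (fun w : seq (step d) =>
        ((ncuts w a (a + 16 ^ k))%:R < c * (16 ^ k)%:R :> R)%:R : R) <=
      C / 2 ^+ k.
Proof.
have [r0 [p p_gt0 le_p]] := prob_cut_mid R d5.
exists r0.+1; exists (p / 6); first by rewrite divr_gt0.
have c_gt0 : 0 < p / 6 by rewrite divr_gt0.
set c := p / 6 in c_gt0 *; have c6 : 6 * c = p by rewrite /c mulrC divfK.
move: c c_gt0 c6 => c c_gt0 c6.
exists (4 / c ^+ 2 + 4 * d%:R ^+ 3 / c).
  by rewrite addr_ge0 // divr_ge0 ?exprn_ge0 ?mulr_ge0 ?exprn_ge0 // ltW.
move=> k a n le_k le_n.
have E16 : (16 ^ k = (4 ^ k) ^ 2)%N by rewrite -expnM mulnC expnM.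
rewrite E16 in le_n *.
have r_ge4 : (4 <= 4 ^ k)%N by rewrite -{1}(expn1 4) leq_exp2l //; lia.
have r_ger0 : (r0 <= 4 ^ k)%N.
  by rewrite ltnW // (leq_trans le_k) // ltnW // ltn_expl.
apply: le_trans (prob_few_cuts_le c_gt0 r_ge4 _ le_n) _.
  by rewrite c6 le_p.
have sqrt4 : Num.sqrt (4 ^ k)%:R = 2 ^+ k :> R.
  have -> : (4 ^ k = (2 ^ k) ^ 2)%N by rewrite -expnM mulnC expnM.
  by rewrite natrX sqrtr_sqr ger0_norm // natrX.
have pow_gt0 : 0 < 2 ^+ k :> R by rewrite exprn_gt0.
rewrite sqrt4 [leRHS](_ : _ =
  4 / (c ^+ 2 * 2 ^+ k) + 4 * d%:R ^+ 3 / (c * 2 ^+ k)); last first.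
  by move: (2 ^+ k) pow_gt0 => z z_gt0; field; rewrite !gt_eqF.
rewrite lerD2r ler_wpM2l // lef_pV2 ?posrE ?mulr_gt0 ?exprn_gt0 ?ltr0n //.
  by rewrite ler_wpM2l ?sqr_ge0 // natrX lerXn2r ?nnegrE // ler_nat.
by rewrite expn_gt0.
Qed.

End Windows.

(** * Late times have cut times close below them *)

Section GoodWalks.
Local Open Scope ring_scope.
Variables (R : realType) (d : nat).
Implicit Types (w u v : seq (step d)).

(** The length [i - s] bounds the distance from the position at time [i] to that at
    time [s], and the number of cut times below [s] is a lower bound for the
    distance from the source to the latter. *)
Definition well_cut M w := all (fun i =>
  has (fun s => cut w s && (i - s < ncuts w 0 s)%N) (iota 0 i))
  (index_iota M (size w).+1).

Definition sparse (c : R) w k j :=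
  (j.+1 * 16 ^ k <= size w)%N &&
  ((ncuts w (j * 16 ^ k) (j.+1 * 16 ^ k))%:R < c * (16 ^ k)%:R).

Definition has_sparse c A k1 w :=
  has (fun k => has (sparse c w k) (index_iota 0 (16 * A)))
      (index_iota k1 (size w).+1).

Lemma has_sparsePn c A k1 w k j :
  ~~ has_sparse c A k1 w -> (k1 <= k <= size w)%N -> (j < 16 * A)%N ->
  (j.+1 * 16 ^ k <= size w)%N ->
  c * (16 ^ k)%:R <= (ncuts w (j * 16 ^ k) (j.+1 * 16 ^ k))%:R.
Proof.
move=> no_sparse k_k1 lt_j le_w; rewrite leNgt; apply: contra no_sparse => lt_c.
apply/hasP; exists k; first by rewrite mem_index_iota ltnS.
by apply/hasP; exists j; rewrite ?mem_index_iota // /sparse le_w.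
Qed.

Lemma ncuts_gt0 w x y : (0 < ncuts w x y)%N -> exists2 s, (x <= s < y)%N & cut w s.
Proof.
move=> n_gt0; have [/hasP[s]|/hasPn no_cut] := boolP (has (cut w) (index_iota x y)).
  by rewrite mem_index_iota => s_xy cut_s; exists s.
move: n_gt0; rewrite /ncuts big1_seq // => s /andP[_ /no_cut].
by move/negPf ->.
Qed.

(** Let [A 16^k <= i < 16 A 16^k] and let [j] be the window of [i] at scale
    [T = 16^k].  Window [j - 1] contains a cut time [s], at distance less than
    [2 T] from [i]; the windows before contain [(j - 1) c T >= 2 T] cut times. *)
Lemma well_cut_of_dense c A k1 w : 0 < c -> (0 < A)%N -> 2 <= A.-1%:R * c ->
  ~~ has_sparse c A k1 w -> well_cut (A * 16 ^ k1) w.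
Proof.
move=> c_gt0 A_gt0 Ac dense; apply/allP => i; rewrite mem_index_iota ltnS.
move=> /andP[le_Mi le_iw]; pose k := trunc_log 16 (i %/ A); pose T := (16 ^ k)%N.
have T_gt0 : (0 < T)%N by rewrite expn_gt0.
have le_k1 : (16 ^ k1 <= i %/ A)%N by rewrite leq_divRL // mulnC.
have iA_gt0 : (0 < i %/ A)%N by rewrite (leq_trans _ le_k1) // expn_gt0.
have /andP[ge_iA lt_iA] := trunc_log_bounds (isT : 1 < 16)%N iA_gt0.
rewrite -/k in ge_iA lt_iA.
have k1_k : (k1 <= k)%N by apply: trunc_log_max.
have AT_i : (A * T <= i)%N by rewrite mulnC -leq_divRL.
have i_AT : (i < A * 16 * T)%N by rewrite -mulnA -expnS mulnC -ltn_divLR.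
have k_w : (k <= size w)%N.
  rewrite (leq_trans _ le_iw) // ltnW //.
  rewrite (leq_trans (ltn_expl k (isT : 1 < 16)%N)) //.
  by rewrite (leq_trans _ AT_i) // leq_pmull.
pose j := (i %/ T)%N.
have A_j : (A <= j)%N by rewrite leq_divRL.
have j_A : (j < 16 * A)%N by rewrite ltn_divLR // [(16 * A)%N]mulnC.
have jT_i : (j * T <= i)%N := leq_trunc_div i T.
have i_jT : (i < j.+1 * T)%N by rewrite ltn_ceil.
have many J : (J < j)%N ->
    c * T%:R <= (ncuts w (J * T) (J.+1 * T))%:R.
  move=> lt_Jj; apply: (has_sparsePn dense); rewrite ?k1_k //.
    exact: ltn_trans lt_Jj j_A.
  by rewrite (leq_trans _ le_iw) // (leq_trans _ jT_i) // leq_mul2r lt_Jj orbT.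
have total J : (J <= j)%N -> J%:R * (c * T%:R) <= (ncuts w 0 (J * T))%:R.
  elim: J => [|J IH] lt_J; first by rewrite mul0r.
  rewrite (@ncuts_cat _ w 0 (J * T)) // ?leq_mul2r ?leqnSn ?orbT //.
  by rewrite natrD -natr1 mulrDl mul1r lerD ?IH ?many // ltnW.
have j1 : j.-1.+1 = j by rewrite prednK // (leq_trans _ A_j).
have := many j.-1; rewrite j1 => /(_ (leqnn _)) le_ncuts.
have [|s /andP[le_s lt_s] cut_s] := @ncuts_gt0 w (j.-1 * T) (j * T).
  by rewrite -(ltr0n R) (lt_le_trans _ le_ncuts) // mulr_gt0 // ltr0n.
apply/hasP; exists s; first by rewrite mem_iota add0n (leq_trans lt_s).
rewrite cut_s /= -(ltr_nat R); apply: (@lt_le_trans _ _ (2 * T)%:R).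
  by rewrite ltr_nat; move: j1 le_s i_jT; nia.
apply: (@le_trans _ _ (ncuts w 0 (j.-1 * T))%:R); last first.
  by rewrite ler_nat ncuts_sub.
apply: le_trans (total j.-1 _); last by rewrite leq_pred.
rewrite natrM mulrA ler_wpM2r // (le_trans Ac) // ler_wpM2r ?(ltW c_gt0) //.
by rewrite ler_nat; lia.
Qed.

Lemma sum_inv_pow2_le k1 n : \sum_(k1 <= k < n) (2 ^+ k)^-1 <= 2 / 2 ^+ k1 :> R.
Proof.
have [/subnKC <-|lt_n] := leqP k1 n; last first.
  by rewrite big_geq ?(ltnW lt_n) // divr_ge0 ?exprn_ge0.
suff : \sum_(k1 <= k < k1 + (n - k1)) (2 ^+ k)^-1 +
    2 / 2 ^+ (k1 + (n - k1)) = 2 / 2 ^+ k1 :> R.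
  by move=> <-; rewrite lerDl divr_ge0 ?exprn_ge0.
elim: (n - k1)%N => [|m IH]; first by rewrite addn0 big_geq ?add0r.
rewrite addnS big_nat_recr ?leq_addr //= -[RHS]IH -addrA; congr (_ + _).
by rewrite exprS; field; rewrite expf_neq0.
Qed.

(** For fixed [A] there are [16 A] windows per scale, so the failure probabilities
    add up to the tail of a geometric series, small for a large first scale. *)
Lemma prob_well_cut (eps : R) : (5 <= d)%N -> 0 < eps ->
  exists M, forall n, 1 - eps <= mean n (fun w => (well_cut M w)%:R).
Proof.
move=> d5 eps_gt0; have st0 := step_gt0 d5.
have [k0 [c c_gt0 [C C_ge0 few]]] := prob_few_cuts_scale R d5.
(* Chosen such that the [A - 1] windows below hold [2 T] cut times. *)
pose A := (Num.bound (2 / c)).+2.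
have Ac : 2 <= A.-1%:R * c.
  rewrite -ler_pdivrMr //; apply: (le_trans (ltW (archi_boundP _))).
    by rewrite divr_ge0 // ltW.
  by rewrite ler_nat.
pose D := 16 * A%:R * C.
have D_ge0 : 0 <= D by rewrite !mulr_ge0.
pose k1 := maxn k0 (Num.bound (D * 2 / eps)).
have k1_eps : D * (2 / 2 ^+ k1) <= eps.
  rewrite mulrA ler_pdivrMr ?exprn_gt0 // -ler_pdivrMl // mulrC.
  apply: (@le_trans _ _ (Num.bound (D * 2 / eps))%:R).
    by rewrite ltW // archi_boundP // divr_ge0 ?mulr_ge0 // ltW.
  by rewrite -natrX ler_nat (leq_trans (leq_maxr k0 _)) // ltnW // ltn_expl.
exists (A * 16 ^ k1)%N; move=> n.
have sparse_le : mean n (fun w => (has_sparse c A k1 w)%:R : R) <= eps.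
  apply: le_trans k1_eps.
  apply: (@le_trans _ _ (mean n (fun w => \sum_(k1 <= k < n.+1)
     \sum_(0 <= j < 16 * A) (sparse c w k j)%:R : R))).
    apply: ler_mean => w <-; apply: has_le_sum => k; exact: has_le_sum.
  apply: le_trans (ler_wpM2l D_ge0 (sum_inv_pow2_le k1 n.+1)).
  rewrite mean_sum mulr_sumr; apply: ler_sum_nat => k /andP[k1_k _].
  rewrite mean_sum (le_trans (_ : _ <= \sum_(0 <= j < 16 * A) C / 2 ^+ k)) //.
    apply: ler_sum_nat => j _.
    have [le_n|lt_n] := leqP (j.+1 * 16 ^ k) n; last first.
      rewrite (eq_mean (g := fun=> 0)) ?mean_cst ?divr_ge0 ?exprn_ge0 //.
      by move=> w sw; rewrite /sparse sw leqNgt lt_n.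
    rewrite mulSnr in le_n.
    apply: le_trans (few k (j * 16 ^ k)%N n _ le_n); last first.
      exact: leq_trans (leq_maxl _ _) k1_k.
    apply: ler_mean => w _; rewrite /sparse mulSnr.
    by case: (_ <= size w)%N.
  by rewrite sumr_const_nat subn0 -[leLHS]mulr_natl natrM /D !mulrA.
apply: (@le_trans _ _ (mean n (fun w => 1 + -1 * (has_sparse c A k1 w)%:R))).
  by rewrite meanD meanZ !mean_cst // mulN1r lerD2l lerN2.
apply: ler_mean => w _.
have := @well_cut_of_dense c A k1 w c_gt0 isT Ac.
case: has_sparse => /=; first by rewrite mulr1 subrr ler0n.
by move=> /(_ isT) ->; rewrite mulr0 addr0.
Qed.

End GoodWalks.

(** * Distances in the trace and cut times *)

Lemma bigmax_seq_attained (S : eqType) (r : seq S) (F : S -> nat) (x0 : S) :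
  x0 \in r -> exists2 x, x \in r & \max_(i <- r) F i = F x.
Proof.
elim: r x0 => [//|i [|j r] IH] x0 _.
  by exists i; rewrite ?mem_head // big_seq1.
have [x xr maxE] := IH j (mem_head _ _); rewrite big_cons maxE.
have [le_ix|/ltnW le_xi] := leqP (F i) (F x).
  by exists x; rewrite ?(maxn_idPr le_ix) // inE xr orbT.
by exists i; rewrite ?mem_head // (maxn_idPl le_xi).
Qed.

Section GraphDistance.
Variables (T : choiceType) (G : finite_graph T).
Implicit Types x y z : T.

Lemma adjC x y : adj G x y = adj G y x.
Proof. by rewrite /adj fsetUC. Qed.

Lemma joined_refl x : joined_by G x x 0.
Proof. by exists [::]. Qed.

Lemma joined_trans x y z m n :
  joined_by G x y m -> joined_by G y z n -> joined_by G x z (m + n).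
Proof.
move=> [p [px py pm]] [q [qy qz qn]]; exists (p ++ q).
by rewrite cat_path last_cat size_cat px py qy qz pm qn.
Qed.

Lemma joined_adj x y : adj G x y -> joined_by G x y 1.
Proof. by move=> xy; exists [:: y]; rewrite /= xy. Qed.

Lemma joined_sym x y n : joined_by G x y n -> joined_by G y x n.
Proof.
move=> [p [px <- <-]] {y n}; elim: p x px => [|z p IH] x /=.
  by move=> _; apply: joined_refl.
by move=> /andP[xz /IH pz]; rewrite -addn1; apply: (joined_trans pz);
  apply: joined_adj; rewrite adjC.
Qed.

Lemma gdist_le x y n : joined_by G x y n -> (gdist G x y <= n)%N.
Proof.
move=> xy; rewrite /gdist; case: pselect => [ex|[]]; last first.
  by exists n; apply/asboolP.
by case: ex_minnP => m _; apply; apply/asboolP.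
Qed.

Lemma gdist_joined x y n : joined_by G x y n -> joined_by G x y (gdist G x y).
Proof.
move=> xy; rewrite /gdist; case: pselect => [ex|[]]; last first.
  by exists n; apply/asboolP.
by case: ex_minnP => m /asboolP.
Qed.

Hypothesis conn : connected_graph G.

Lemma connected_gdist x y : x \in vertices G -> y \in vertices G ->
  joined_by G x y (gdist G x y).
Proof.
move=> xG yG; have [n xy] := conn.2 _ _ xG yG; exact: gdist_joined xy.
Qed.

Lemma gdistC x y : x \in vertices G -> y \in vertices G ->
  gdist G x y = gdist G y x.
Proof.
by move=> xG yG; apply/eqP; rewrite eqn_leq !gdist_le //;
  apply: joined_sym; apply: connected_gdist.
Qed.

Lemma gdist_triangle x y z :
  x \in vertices G -> y \in vertices G -> z \in vertices G ->
  (gdist G x z <= gdist G x y + gdist G y z)%N.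
Proof.
by move=> xG yG zG; apply: gdist_le; apply: joined_trans; apply: connected_gdist.
Qed.

Lemma gdist_le_diam x y : x \in vertices G -> y \in vertices G ->
  (gdist G x y <= diam G)%N.
Proof.
move=> xG yG; rewrite /diam (bigD1_seq x) ?fset_uniq //= leq_max.
by rewrite (bigD1_seq y) ?fset_uniq //= leq_max leqnn.
Qed.

Lemma diametric_pairs_neq0 : diametric_pairs G != fset0%fset.
Proof.
have [/fset0Pn[x0 x0G] _] := conn.
have [x xG maxx] := bigmax_seq_attained
  (fun x => \max_(y <- vertices G) gdist G x y) x0G.
have [y yG maxy] := bigmax_seq_attained (gdist G x) x0G.
apply/fset0Pn; exists (x, y); rewrite !inE /= xG yG /=.
by rewrite /diam maxx maxy.
Qed.

Lemma diametric_pairsP (p : T * T) : p \in diametric_pairs G ->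
  [/\ p.1 \in vertices G, p.2 \in vertices G & gdist G p.1 p.2 = diam G].
Proof. by rewrite !inE => /andP[/andP[p1 p2] /eqP]. Qed.

Variable closest : finite_graph T -> T -> nat -> {fset T}.
Hypothesis closestP : closest_rule closest.

(** If [v] were left out, the selected vertices would be [size s] many (the rule
    does not output the whole graph), all at least as close to [u] as [v]; with
    [v] itself they would be too many for [s]. *)
Lemma mem_closest u v (s : seq T) :
  u \in vertices G -> v \in vertices G ->
  (forall x, x \in vertices G -> (gdist G u x <= gdist G u v)%N -> x \in s) ->
  v \in closest G u (size s).
Proof.
move=> uG vG ball; have [sub card_cl near] := closestP (size s) conn uG.
apply: contraT => v_far.
have vD : v \in (vertices G `\` closest G u (size s))%fset by rewrite inE v_far.
have v_s : v \in s by apply: ball.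
have lt_card (r : seq T) : v \in r -> {subset closest G u (size s) <= r} ->
    (#|` closest G u (size s)| < size r)%N.
  move=> v_r sub_r; apply: (@uniq_leq_size _ (v :: closest G u (size s))).
    by rewrite /= v_far fset_uniq.
  by move=> x; rewrite inE => /predU1P[-> //|/sub_r].
have lt_s := lt_card s v_s _; have lt_G := lt_card (vertices G) vG (fsubsetP sub).
move: lt_s lt_G; rewrite card_cl.
have sub_s : {subset closest G u (size s) <= s}.
  by move=> x x_cl; apply: ball; [apply: (fsubsetP sub)|apply: near].
by move=> /(_ sub_s); lia.
Qed.

End GraphDistance.

Section TraceGraph.
Local Open Scope ring_scope.
Variables (d : nat) (v : 'rV[int]_d) (w : seq (step d)).
Let X := walk v w.
Let G := trace v w.

Lemma walkE i : X i = v + pos (take i w).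
Proof. by []. Qed.

Lemma walk0 : X 0 = v.
Proof. by rewrite walkE take0 pos_nil addr0. Qed.

Lemma walk_inj_pos i j : X i = X j -> pos (take i w) = pos (take j w).
Proof. by rewrite !walkE => /addrI. Qed.

Lemma traceP x : reflect (exists2 i, (i <= size w)%N & x = X i) (x \in vertices G).
Proof.
apply: (iffP idP) => [/imfsetP[i _ ->]|[i le_iw ->]].
  by exists (val i) => //; rewrite -ltnS; apply: ltn_ord.
by apply/imfsetP; exists (Ordinal (le_iw : (i < (size w).+1)%N)).
Qed.

Lemma walk_in i : (i <= size w)%N -> X i \in vertices G.
Proof. by move=> le_iw; apply/traceP; exists i. Qed.

Lemma trace_adjP x y : adj G x y -> exists2 i, (i < size w)%N &
  x = X i /\ y = X i.+1 \/ x = X i.+1 /\ y = X i.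
Proof.
move=> /imfsetP[i _ /= xy]; exists (val i); first exact: ltn_ord.
set a := walk _ _ _ in xy.
set b := walk _ _ _ in xy; rewrite /X -/a -/b.
have /fset2P xab : x \in [fset a; b]%fset by rewrite -xy !inE eqxx.
have /fset2P yab : y \in [fset a; b]%fset by rewrite -xy !inE eqxx orbT.
have /fset2P axy : a \in [fset x; y]%fset by rewrite xy !inE eqxx.
have /fset2P bxy : b \in [fset x; y]%fset by rewrite xy !inE eqxx orbT.
case: xab => xE; [left|right]; split=> //.
  by case: bxy => // bE; case: yab => // yE; rewrite yE -xE -bE.
by case: axy => // aE; case: yab => // yE; rewrite yE -xE -aE.
Qed.

Lemma adj_walk i : (i < size w)%N -> adj G (X i) (X i.+1).
Proof. by move=> lt_iw; apply/imfsetP; exists (Ordinal lt_iw). Qed.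

Lemma joined_walk i j : (i <= j)%N -> (j <= size w)%N ->
  joined_by G (X i) (X j) (j - i).
Proof.
move=> le_ij; rewrite -{1 2}(subnKC le_ij); elim: (j - i)%N => [|m IH] le_w.
  by rewrite addn0; apply: joined_refl.
rewrite -[m.+1 in X in joined_by _ _ _ X]addn1.
apply: joined_trans (IH _) _; first by lia.
by rewrite addnS; apply/joined_adj/adj_walk; lia.
Qed.

Lemma trace_connected : connected_graph G.
Proof.
split; first by apply/fset0Pn; exists (X 0); apply: walk_in.
move=> _ _ /traceP[i le_i ->] /traceP[j le_j ->].
have [le_ij|/ltnW le_ji] := leqP i j; first by exists (j - i)%N; apply: joined_walk.
by exists (i - j)%N; apply/joined_sym/joined_walk.
Qed.

(** A cut time in between would separate the two visits. *)
Lemma ncuts_walk_eq a b : (b <= size w)%N -> (a <= b)%N -> X a = X b ->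
  ncuts w a b = 0%N.
Proof.
move=> le_b le_ab ab; rewrite /ncuts big_nat big1 // => s /andP[le_as lt_sb].
apply/eqP; rewrite eqb0; apply/negP => /cutP/(_ a b le_as).
by rewrite lt_sb le_b; apply => //; apply: walk_inj_pos.
Qed.

Lemma ncuts0_walk_eq a b : (a <= size w)%N -> (b <= size w)%N -> X a = X b ->
  ncuts w 0 a = ncuts w 0 b.
Proof.
wlog le_ab : a b / (a <= b)%N => [wl a_w b_w ab|a_w b_w ab].
  have [/wl-> //|/ltnW le_ba] := leqP a b.
  by rewrite (wl b a).
by rewrite (@ncuts_cat _ w 0 a b) // (ncuts_walk_eq b_w le_ab ab) addn0.
Qed.

(** Along an edge of the trace the number of cut times below changes by at most
    one, so it is a Lipschitz function for the distance of the trace. *)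
Lemma ncuts_le_joined a b N : (a <= size w)%N -> (b <= size w)%N ->
  joined_by G (X a) (X b) N -> (ncuts w 0 b <= ncuts w 0 a + N)%N.
Proof.
move=> le_a le_b [p [pa pb <-]]; elim: p a le_a pa pb => [|x p IH] a le_a /=.
  by move=> _ /(ncuts0_walk_eq le_a le_b) ->; rewrite addn0.
case/andP=> /trace_adjP[i lt_i]; have le_i := ltnW lt_i.
have ncutsS : (ncuts w 0 i.+1 = ncuts w 0 i + cut w i)%N.
  by rewrite /ncuts big_nat_recr.
have cut_le1 : (cut w i <= 1)%N by case: cut.
case=> -[/ncuts0_walk_eq-/(_ le_a) -> // ->] px lastx.
    apply: leq_trans (IH i.+1 lt_i px lastx) _.
  by rewrite ncutsS -addnA leq_add2l -[leqRHS]add1n leq_add2r.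
apply: leq_trans (IH i le_i px lastx) _.
by rewrite leq_add // ncutsS leq_addr.
Qed.

(** The first edge of the path that leaves the positions up to time [s] can only
    be the step made at time [s]. *)
Lemma joined_through_cut s a b N : (s < size w)%N -> cut w s ->
  (a <= s < b)%N -> (b <= size w)%N -> joined_by G (X a) (X b) N ->
  exists N1 N2, [/\ N = (N1 + N2)%N, joined_by G (X a) (X s) N1 &
    joined_by G (X s) (X b) N2].
Proof.
move=> lt_s /cutP cut_s /andP[le_as lt_sb] le_b [p [pa pb <-]].
have sep i j : (i <= s)%N -> (s < j <= size w)%N -> X i <> X j.
  by move=> le_i j_s /walk_inj_pos; apply: cut_s.
elim: p a le_as pa pb => [|x p IH] a le_as /=.
  by move=> _ ab; case: (sep a b le_as _ ab); rewrite lt_sb.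
case/andP=> ax px lastx; have adj_ax := joined_adj ax.
have continue_left j : (j <= s)%N -> x = X j -> exists N1 N2,
    [/\ (size p).+1 = (N1 + N2)%N, joined_by G (X a) (X s) N1 &
      joined_by G (X s) (X b) N2].
  move=> le_j xE; rewrite xE in px lastx adj_ax.
  have [N1 [N2 [pN j1 j2]]] := IH j le_j px lastx.
  exists N1.+1, N2; rewrite pN addSn; split=> //.
  exact: joined_trans adj_ax j1.
have [i lt_i [[aE xE]|[aE xE]]] := trace_adjP ax.
  have le_is : (i <= s)%N.
    rewrite leqNgt; apply/negP => lt_si; apply: (sep a i) => //.
    by rewrite lt_si ltnW.
  move: le_is; rewrite leq_eqVlt => /predU1P[i_s|lt_is]; last first.
    exact: continue_left xE.
  exists 0%N, (size p).+1; rewrite add0n -i_s -aE; split=> //.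
    exact: joined_refl.
  by exists (x :: p); rewrite /= ax px.
have lt_is : (i < s)%N.
  by rewrite ltnNge; apply/negP => le_si; apply: (sep a i.+1); rewrite // ltnS le_si.
by apply: continue_left xE; rewrite ltnW.
Qed.

(** Otherwise the source would be farther from [X j] than [X i] is: each path
    from the source to [X j] passes through [X s], from which the source is
    farther than [X i]. *)
Lemma diametric_early M i j : well_cut M w -> (i <= j <= size w)%N ->
  gdist G (X i) (X j) = diam G -> (i < M)%N.
Proof.
move=> /allP wc /andP[le_ij le_j] ij_diam; rewrite ltnNge; apply/negP => le_Mi.
have le_i : (i <= size w)%N := leq_trans le_ij le_j.
have /hasP[s] : has (fun s => cut w s && (i - s < ncuts w 0 s)%N) (iota 0 i).
  by apply: wc; rewrite mem_index_iota le_Mi ltnS.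
rewrite mem_iota add0n => /= lt_si /andP[cut_s far_s].
have lt_sw : (s < size w)%N := leq_trans lt_si le_i.
have conn := trace_connected.
have G0 := walk_in (leq0n (size w)); have Gs := walk_in (ltnW lt_sw).
have Gi := walk_in le_i; have Gj := walk_in le_j.
have [|N1 [N2 [D_N j1 j2]]] := joined_through_cut lt_sw cut_s _ le_j
  (connected_gdist conn G0 Gj).
  by rewrite leq0n (leq_trans lt_si).
have le_D := gdist_le_diam G0 Gj.
have ncuts00 : ncuts w 0 0 = 0%N by rewrite /ncuts big_geq.
have far0 := ncuts_le_joined (leq0n (size w)) (ltnW lt_sw) j1.
rewrite ncuts00 add0n in far0.
have si : (gdist G (X i) (X s) <= i - s)%N.
  by apply/gdist_le/joined_sym; apply: joined_walk (ltnW lt_si) le_i.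
have sj : (gdist G (X s) (X j) <= N2)%N by apply: gdist_le.
have le_ij_diam := gdist_triangle conn Gi Gs Gj.
have : (diam G < diam G)%N.
  rewrite -{1}ij_diam (leq_ltn_trans le_ij_diam) // (leq_trans _ le_D) // D_N.
  rewrite -addSn leq_add // (leq_ltn_trans si) // (leq_trans far_s) //.
by rewrite ltnn.
Qed.

End TraceGraph.

(** * Lattice balls and the source *)

Section LatticeBalls.
Local Open Scope ring_scope.
Variable d : nat.
Implicit Types (x y u v : 'rV[int]_d) (w : seq (step d)).

(** The end points of the lattice paths of length at most [m], listed with
    repetitions: only a bound on their number that is uniform in [u] matters. *)
Fixpoint lattice_ball m u : seq 'rV[int]_d :=
  if m is m'.+1 then
    u :: flatten [seq lattice_ball m' (u + step_vec s) | s <- enum (step d)]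
  else [:: u].

Lemma size_lattice_ball m u u' :
  size (lattice_ball m u) = size (lattice_ball m u').
Proof.
elim: m u u' => [//|m IH] u u' /=; congr _.+1.
rewrite !size_flatten /shape -!map_comp; congr sumn.
by apply: eq_map => s /=; apply: IH.
Qed.

Lemma step_vec_opp (s : step d) : exists s', step_vec s' = - step_vec s.
Proof.
by exists (s.1, ~~ s.2); rewrite /step_vec signrN scaleNr.
Qed.

Lemma trace_adj_step v w x y : adj (trace v w) x y ->
  exists s : step d, y = x + step_vec s.
Proof.
move=> /trace_adjP[i /(walkS v)[s stepE] [[-> ->]|[-> ->]]]; first by exists s.
have [s' s'E] := step_vec_opp s; exists s'.
by rewrite stepE s'E addrK.
Qed.

Lemma path_lattice_ball v w m x p : path (adj (trace v w)) x p ->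
  (size p <= m)%N -> last x p \in lattice_ball m x.
Proof.
elim: m x p => [|m IH] x [|y p] //=; rewrite ?mem_head // => /andP[xy py] le_m.
rewrite inE; apply/orP; right.
have [s yE] := trace_adj_step xy; apply/flattenP.
exists (lattice_ball m y); last exact: IH.
by apply/mapP; exists s; rewrite ?mem_enum // -yE.
Qed.

Variables (R : realType).
Variable closest :
  finite_graph 'rV[int]_d -> 'rV[int]_d -> nat -> {fset 'rV[int]_d}.
Hypothesis closestP : closest_rule closest.

Lemma source_near_early M v w i : (i < M)%N -> (i <= size w)%N ->
  v \in closest (trace v w) (walk v w i) (size (lattice_ball M (0 : 'rV[int]_d))).
Proof.
move=> lt_iM le_i; have conn := trace_connected v w.
have vG : v \in vertices (trace v w) by rewrite -{1}(walk0 v w) walk_in.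
have uG := walk_in v le_i; set u := walk v w i in uG *.
rewrite (size_lattice_ball M 0 u); apply: mem_closest => // x xG le_x.
have le_uv : (gdist (trace v w) u v <= i)%N.
  apply/gdist_le/joined_sym; rewrite -{2}(walk0 v w) -[i in X in joined_by _ _ _ X]subn0.
  exact: joined_walk.
have [p [up lastx sp]] := connected_gdist conn uG xG.
rewrite -lastx; apply: path_lattice_ball up _; rewrite sp.
by rewrite (leq_trans le_x) // (leq_trans le_uv) // ltnW.
Qed.

Lemma source_in_Lambda_of M v w p : well_cut M w ->
  p \in diametric_pairs (trace v w) ->
  v \in Lambda_of closest (size (lattice_ball M (0 : 'rV[int]_d))).*2 (trace v w) p.
Proof.
move=> wc /diametric_pairsP[/traceP[i le_i p1E] /traceP[j le_j p2E]].
rewrite p1E p2E => ij_diam; rewrite /Lambda_of doubleK p1E p2E inE.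
have conn := trace_connected v w.
have [le_ij|/ltnW le_ji] := leqP i j; apply/orP; [left|right].
  by apply: source_near_early => //; apply: diametric_early wc _ ij_diam; rewrite le_ij.
apply: source_near_early => //; apply: (@diametric_early _ v w M j i) => //.
  by rewrite le_ji.
by rewrite gdistC ?walk_in.
Qed.

Lemma Lambda_prob_ge0 k (G : finite_graph 'rV[int]_d) P :
  0 <= Lambda_prob closest R k G P.
Proof. by rewrite divr_ge0. Qed.

Lemma Lambda_prob_well_cut M v w : well_cut M w ->
  Lambda_prob closest R (size (lattice_ball M (0 : 'rV[int]_d))).*2 (trace v w)
    (fun L => v \in L) = 1.
Proof.
move=> wc; rewrite /Lambda_prob (_ : [fset p in _ | _]%fset = diametric_pairs (trace v w)).
  rewrite divff // pnatr_eq0 cardfs_eq0.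
  exact/diametric_pairs_neq0/trace_connected.
apply/fsetP => p; have := @source_in_Lambda_of M v w p wc; rewrite !inE /=.
by case: (_ && (_ == diam _)) => //= /(_ isT) ->.
Qed.

Lemma source_in_Lambda_probE k v n : source_in_Lambda_prob R closest k v n =
  mean n (fun w => Lambda_prob closest R k (trace v w) (fun L => v \in L)).
Proof.
by rewrite mean_tupleE card_step.
Qed.

End LatticeBalls.

Lemma limn_einf_ge (R : realType) (u : nat -> \bar R) (l : \bar R) :
  (forall n, l <= u n)%E -> (l <= limn_einf u)%E.
Proof.
move=> le_u; rewrite limn_einf_lim; apply: lime_ge; first exact: is_cvg_einfs.
by apply: nearW => n; apply: le_ereal_inf_tmp => _ [m _ <-].
Qed.

Theorem theorem1p4 (R : realType) (d : nat) (hd : (5 <= d)%N)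
    (eps : R) (eps_gt0 : (0 < eps)%R) (eps_lt1 : (eps < 1)%R) :
  exists K : nat, [/\ (2 <= K)%N, ~~ odd K &
    forall (closest : finite_graph 'rV[int]_d -> 'rV[int]_d -> nat ->
                      {fset 'rV[int]_d}) (v : 'rV[int]_d),
      closest_rule closest ->
      ((1 - eps)%:E <=
        limn_einf (fun n => (source_in_Lambda_prob R closest K v n)%:E))%E].
Proof.
have [M prob_M] := prob_well_cut hd eps_gt0.
exists (size (lattice_ball M (0%R : 'rV[int]_d))).*2; split.
- by rewrite (leq_double 1); case: (M).
- by rewrite odd_double.
move=> closest v closestP; apply: limn_einf_ge => n; rewrite lee_fin.
rewrite source_in_Lambda_probE; apply: le_trans (prob_M n) _.
apply: ler_mean => w _; have [wc|_] := boolP (well_cut M w).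
  by rewrite Lambda_prob_well_cut.
exact: Lambda_prob_ge0.
Qed.
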